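(* Let $d_n$ be a sequence of directed metrics of negative sign on $\mathbb{R}^2$ satisfying the following conditions. 1. Let $\le$ be the total order on $\mathbb{R}^2$ given by $(x,s)\le(y,t)$ if $s<t$, or if $s=t$ and $x\le y$. Then $d_n(u;v)=-\infty$ for $v<u$. (So the only compatible order on any $d_n$-geodesic is the order $\le$.) 2. Any $d_n$-geodesic is the image of a continuous curve $\pi:[0,1]\to\mathbb{R}^2$ satisfying $\pi(s)\le\pi(t)$ for $s\le t$. 3. The sequence $\mathfrak{h}d_n$ converges to the closed hypograph of a spacetime metric $d$ in $\mathcal{E}_*$. Suppose that $(u_n,v_n)\to(u,v)\in\mathbb{R}^4_\uparrow$ and that $d_n(u_n,v_n)>-\infty$ for all large enough $n$. Then any sequence of closures $\bar\Gamma_n$ of $d_n$-geodesics $\Gamma_n$ from $u_n$ to $v_n$ is precompact in the Hausdorff topology. Moreover, if there is a unique $d$-geodesic $\Gamma$ from $u$ to $v$ then $\bar\Gamma_n\to\Gamma$.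
   Context: A directed metric of negative sign on $\mathbb{R}^2$ is $d:\mathbb{R}^2\times\mathbb{R}^2\to\mathbb{R}\cup\{-\infty\}$ with $d(p,p)=0$ and $d(p,r)\ge d(p,q)+d(q,r)$. For $d(p,q)>-\infty$, a $d$-geodesic set from $p$ to $q$ is a set $A\subset\mathbb{R}^2$ containing $p,q$ admitting a total order $\preceq$ (a compatible order) with least element $p$, greatest element $q$ and $d(a,c)=d(a,b)+d(b,c)$ for all $a\preceq b\preceq c$ in $A$; a $d$-geodesic is a geodesic set from $p$ to $q$ maximal under inclusion. $\mathbb{R}^4_\uparrow=\{(x,s;y,t)\in\mathbb{R}^4:s<t\}$, $\mathbb{R}^4_\circ=\{(p,q)\in\mathbb{R}^2\times\mathbb{R}^2:p\ne q\}$, $\bar{\mathbb{R}}=[-\infty,\infty]$. Spacetime metric: a directed metric $d$ of negative sign on $\mathbb{R}^2$, continuous on $\mathbb{R}^4_\circ$ (with values in $\bar{\mathbb{R}}$), such that (1) $d>-\infty$ on $\mathbb{R}^4_\uparrow$, $d=0$ on the diagonal $\{(p,p)\}$, and $d=-\infty$ everywhere else; (2) for all $s<r<t$ and $x,y\in\mathbb{R}$, $d(x,s;y,t)=\max_{z\in\mathbb{R}}d(x,s;z,r)+d(z,r;y,t)$; (3) for any $(x,s;y,t)\in\mathbb{R}^4_\uparrow$ there is a compact set $[a,b]\times[s,t]$ containing all geodesics from $(x,s)$ to $(y,t)$. Hypograph convergence in $\mathcal{E}_*$: for $f:\mathbb{R}^4_\circ\to\bar{\mathbb{R}}$, $\mathfrak{h}f$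 is the closure of $\{(r,a):a\le f(r)\}$ in $\mathbb{R}^4_\circ\times\bar{\mathbb{R}}$; with $E(r,a)=(r,|p-q|e^{-|r|}a/(1+|a|))$, $r=(p,q)$ ($a/(1+|a|)=\pm1$ at $\pm\infty$), $\mathfrak{h}f_n\to\mathfrak{h}f$ if the Hausdorff distance between $E(\mathfrak{h}f_n)$ and $E(\mathfrak{h}f)$ tends to $0$. *)

(* Defs.v *)
From HB Require Import structures.
From mathcomp Require Import all_boot all_order all_algebra.
From mathcomp Require Import lra.
From mathcomp Require Import all_classical all_reals all_analysis.

Set Implicit Arguments.
Unset Strict Implicit.
Unset Printing Implicit Defensive.

Import Order.TTheory GRing.Theory Num.Theory.
Import numFieldNormedType.Exports.

Local Open Scope classical_set_scope.
Local Open Scope ring_scope.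

(* A point (x, s) of the plane has spatial coordinate x and time s. *)
Notation plane R := (R * R)%type.

Section Euclidean.
Context {R : realType}.

(* The library's norm on a product is the maximum norm. *)
Definition enorm2 (p : plane R) : R := Num.sqrt (p.1 ^+ 2 + p.2 ^+ 2).

Definition enorm4 (r : plane R * plane R) : R :=
  Num.sqrt (r.1.1 ^+ 2 + r.1.2 ^+ 2 + r.2.1 ^+ 2 + r.2.2 ^+ 2).

Definition edist2 (p q : plane R) : R := enorm2 (p - q).

Definition edist5 (x y : (plane R * plane R) * R) : R :=
  Num.sqrt (enorm4 (x.1 - y.1) ^+ 2 + (x.2 - y.2) ^+ 2).

Lemma edist2xx p : edist2 p p = 0.
Proof. by rewrite /edist2 /enorm2 subrr/= expr0n addr0 sqrtr0. Qed.

Lemma edist2C p q : edist2 p q = edist2 q p.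
Proof.
rewrite /edist2 /enorm2/=; congr Num.sqrt.
by congr (_ + _); rewrite -sqrrN opprB.
Qed.

Lemma enorm2D p q : enorm2 (p + q) <= enorm2 p + enorm2 q.
Proof.
case: p q => [a b] [c d]; rewrite /enorm2/=.
have p0 : 0 <= a ^+ 2 + b ^+ 2 by rewrite addr_ge0 ?sqr_ge0.
have q0 : 0 <= c ^+ 2 + d ^+ 2 by rewrite addr_ge0 ?sqr_ge0.
have h0 : 0 <= Num.sqrt (a ^+ 2 + b ^+ 2) + Num.sqrt (c ^+ 2 + d ^+ 2).
  by rewrite addr_ge0 ?sqrtr_ge0.
rewrite -[leRHS]ger0_norm// -sqrtr_sqr; apply: ler_wsqrtr.
rewrite [leRHS]sqrrD !sqr_sqrtr// -sqrtrM//.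
have : a * c + b * d <= Num.sqrt ((a ^+ 2 + b ^+ 2) * (c ^+ 2 + d ^+ 2)).
  apply: (le_trans (ler_norm _)); rewrite -sqrtr_sqr; apply: ler_wsqrtr.
  have := sqr_ge0 (a * d - b * c); nra.
by rewrite -mulr_natl => cs; nra.
Qed.

Lemma edist2_triangle q p r : edist2 p r <= edist2 p q + edist2 q r.
Proof.
have -> : edist2 p r = enorm2 ((p - q) + (q - r)) by rewrite addrA subrK.
exact: enorm2D.
Qed.

End Euclidean.

Section Hausdorff.
Context {R : realType} {T : Type} (dist : T -> T -> R).

Definition excess (A B : set T) : \bar R :=
  ereal_sup [set ereal_inf [set (dist a b)%:E | b in B] | a in A].

Definition hausdorff_dist (A B : set T) : \bar R :=
  maxe (excess A B) (excess B A).

Lemma hausdorff_distC A B : hausdorff_dist A B = hausdorff_dist B A.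
Proof. exact: maxC. Qed.

Lemma excess_lt A B (e : R) : (excess A B < e%:E)%E ->
  exists2 e' : R, e' < e & forall a, A a -> exists2 b, B b & dist a b < e'.
Proof.
move=> ABe.
have [e' Ae' e'e] : exists2 e' : R, (excess A B < e'%:E)%E & e' < e.
  move: ABe; case: (excess A B) => [r||]//.
    rewrite lte_fin => re; exists ((r + e) / 2); last by rewrite midf_lt.
    by rewrite lte_fin midf_lt.
  by move=> _; exists (e - 1); [exact: ltNyr|rewrite ltrBlDr ltrDl].
exists e' => // a Aa.
have : (ereal_inf [set (dist a b)%:E | b in B] < e'%:E)%E.
  by apply: le_lt_trans Ae'; apply: ereal_sup_ubound; exists a.
by move=> /ereal_inf_lt[_ [b Bb <-]]; rewrite lte_fin => ab; exists b.
Qed.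

Lemma excess_le A B (e : R) :
  (forall a, A a -> exists2 b, B b & dist a b <= e) -> (excess A B <= e%:E)%E.
Proof.
move=> AB; apply: ge_ereal_sup => _ [a /AB[b Bb abe] <-].
by apply: ereal_inf_le; exists (dist a b)%:E; [exists b|rewrite lee_fin].
Qed.

Hypothesis distxx : forall x, dist x x = 0.
Hypothesis dist_triangle : forall y x z, dist x z <= dist x y + dist y z.

Lemma hausdorff_dist_xx A (e : R) : 0 < e -> (hausdorff_dist A A < e%:E)%E.
Proof.
move=> e0; rewrite /hausdorff_dist maxxx; apply: (@le_lt_trans _ _ 0%:E).
  by apply: excess_le => a Aa; exists a => //; rewrite distxx.
by rewrite lte_fin.
Qed.

Lemma excess_triangle A B C (e1 e2 : R) : (excess A B < e1%:E)%E ->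
  (excess B C < e2%:E)%E -> (excess A C < (e1 + e2)%:E)%E.
Proof.
move=> /excess_lt[d1 d1e1 AB] /excess_lt[d2 d2e2 BC].
apply: (@le_lt_trans _ _ (d1 + d2)%:E); last by rewrite lte_fin ltrD.
apply: excess_le => a /AB[b /BC[c Cc bc] ab]; exists c => //.
by rewrite (le_trans (dist_triangle b _ _))// lerD// ltW.
Qed.

Lemma hausdorff_dist_triangle A B C (e1 e2 : R) :
  (hausdorff_dist A B < e1%:E)%E -> (hausdorff_dist B C < e2%:E)%E ->
  (hausdorff_dist A C < (e1 + e2)%:E)%E.
Proof.
rewrite /hausdorff_dist !gt_max => /andP[AB BA] /andP[BC CB]; apply/andP; split.
  exact: excess_triangle AB BC.
by rewrite addrC; exact: excess_triangle CB BA.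
Qed.

End Hausdorff.

(* The closed subsets of the plane with the Hausdorff topology. The Hausdorff
   distance takes the value +oo, so it is not an instance of isMetric; only its
   balls of finite radius are needed. The nonempty compact sets form a clopen
   part of this space. *)
Record closed_set (R : realType) := ClosedSet {
  closed_set_val :> set (plane R);
  closed_set_closed : closed closed_set_val }.

Section HausdorffTopology.
Context {R : realType}.

HB.instance Definition _ := gen_eqMixin (closed_set R).
HB.instance Definition _ := gen_choiceMixin (closed_set R).

Let hball (A : closed_set R) (e : R) (B : closed_set R) : Prop :=
  (hausdorff_dist edist2 A B < e%:E)%E.

Let hent : set_system (closed_set R * closed_set R) := entourage_ hball.

Let hnbhs (A : closed_set R) : set_system (closed_set R) := nbhs_ hent A.

Let hnbhsE : hnbhs = nbhs_ hent. Proof. by []. Qed.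

HB.instance Definition _ := hasNbhs.Build (closed_set R) hnbhs.

Let hball_center A (e : R) : 0 < e -> hball A e A.
Proof. exact: (hausdorff_dist_xx edist2xx). Qed.

Let hball_sym A B (e : R) : hball A e B -> hball B e A.
Proof. by rewrite /hball hausdorff_distC. Qed.

Let hball_triangle A B C (e1 e2 : R) :
  hball A e1 B -> hball B e2 C -> hball A (e1 + e2) C.
Proof. exact: (hausdorff_dist_triangle edist2_triangle). Qed.

Let hentE : hent = entourage_ hball. Proof. by []. Qed.

HB.instance Definition _ := @Nbhs_isPseudoMetric.Build R (closed_set R)
  hent hnbhsE hball hball_center hball_sym hball_triangle hentE.

Definition set_closure (A : set (plane R)) : closed_set R :=
  ClosedSet (@closed_closure _ A).

End HausdorffTopology.

Section DirectedMetrics.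
Context {R : realType}.
Implicit Types (d : plane R -> plane R -> \bar R) (p q : plane R)
  (A G : set (plane R)).

Definition directed_metric_neg d : Prop :=
  [/\ forall p q, (d p q < +oo)%E,
      forall p, d p p = 0%E
    & forall p q r, (d p q + d q r <= d p r)%E].

Definition total_order_on A (le : plane R -> plane R -> Prop) : Prop :=
  [/\ forall a, A a -> le a a,
      forall a b, A a -> A b -> le a b -> le b a -> a = b,
      forall a b c, A a -> A b -> A c -> le a b -> le b c -> le a c
    & forall a b, A a -> A b -> le a b \/ le b a].

Definition compatible_order d p q A (le : plane R -> plane R -> Prop) : Prop :=
  [/\ total_order_on A le,
      forall a, A a -> le p a,
      forall a, A a -> le a q
    & forall a b c, A a -> A b -> A c -> le a b -> le b c ->
        d a c = (d a b + d b c)%E].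

Definition geodesic_set d p q A : Prop :=
  [/\ (-oo < d p q)%E, A p, A q & exists le, compatible_order d p q A le].

Definition geodesic d p q A : Prop :=
  geodesic_set d p q A /\
  forall B, geodesic_set d p q B -> A `<=` B -> B = A.

Definition R4up : set (plane R * plane R) := [set r | r.1.2 < r.2.2].

Definition R4o : set (plane R * plane R) := [set r | r.1 <> r.2].

Definition spacetime_metric d : Prop :=
  [/\ directed_metric_neg d,
      {within R4o, continuous (fun r : plane R * plane R => d r.1 r.2)},
      [/\ forall p q, R4up (p, q) -> (-oo < d p q)%E,
          forall p, d p p = 0%E
        & forall p q, p <> q -> ~ R4up (p, q) -> d p q = -oo%E],
      forall s r t x y : R, s < r -> r < t ->
        (exists z, d (x, s) (y, t) = (d (x, s) (z, r) + d (z, r) (y, t))%E) /\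
        (forall z, (d (x, s) (z, r) + d (z, r) (y, t) <= d (x, s) (y, t))%E)
    & forall x s y t : R, R4up ((x, s), (y, t)) ->
        exists a b : R, forall G, geodesic d (x, s) (y, t) G ->
          G `<=` `[a, b]%classic `*` `[s, t]%classic].

(* The closure in R4o * \bar R is the trace on it of the closure in the whole
   product. *)
Definition hypograph d : set ((plane R * plane R) * \bar R) :=
  closure [set x | R4o x.1 /\ (x.2 <= d x.1.1 x.1.2)%E] `&` [set x | R4o x.1].

(* contract a is a / (1 + |a|), with values -1 and 1 at -oo and +oo. *)
Definition hypo_embed (x : (plane R * plane R) * \bar R) :
    (plane R * plane R) * R :=
  (x.1, enorm2 (x.1.1 - x.1.2) * expR (- enorm4 x.1) * contract x.2).

Definition hypo_cvg (dn : nat -> plane R -> plane R -> \bar R) d : Prop :=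
  (fun n => hausdorff_dist edist5
     (hypo_embed @` hypograph (dn n)) (hypo_embed @` hypograph d))
    @ \oo --> 0%E.

Definition time_le p q : Prop := p.2 < q.2 \/ (p.2 = q.2 /\ p.1 <= q.1).

Definition time_lt p q : Prop := time_le p q /\ p <> q.

Definition monotone_curve_image G : Prop :=
  exists c : R -> plane R,
    [/\ {within `[0, 1], continuous c},
        c @` `[0, 1]%classic = G
      & forall s t, 0 <= s -> s <= t -> t <= 1 -> time_le (c s) (c t)].

End DirectedMetrics.

(* Main.v *)
Require Import Defs.
From HB Require Import structures.
From mathcomp Require Import all_boot all_order all_algebra.
From mathcomp Require Import lra.
From mathcomp Require Import all_classical all_reals all_analysis.

Set Implicit Arguments.
Unset Strict Implicit.
Unset Printing Implicit Defensive.

Import Order.TTheory GRing.Theory Num.Theory.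
Import numFieldNormedType.Exports.

Local Open Scope classical_set_scope.
Local Open Scope ring_scope.

(* Hypograph convergence gives two things: dn is asymptotically at most d off
   the diagonal, and every pair p, q with p.2 < q.2 is the limit of good pairs
   pn, qn along which dn does not drop below d p q. Hence limits of points of
   dn-geodesics between good pairs lie on d-geodesics. The endpoints un, vn need
   not be good, so Gn is compared with dn-geodesics Ln of good pairs that start
   slightly before u and end slightly after v, and pass strictly on one side of
   un and of vn: this holds because d is -oo between distinct points of the same
   time. A point e of Gn on the wrong side of Ln lies on Gn between two crossings
   of Gn and Ln, and then the triangle inequality shows that e itself lies on a
   dn-geodesic of the good pair. So every point of Gn is squeezed, at its own
   time, between points of dn-geodesics of good pairs close to (u, v), one on each
   side. Such points stay bounded, as otherwise a dn-geodesic through them, being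
   a continuous curve, would meet a fixed vertical line that no d-geodesic from u
   to v meets; Blaschke's selection theorem then gives precompactness. If the
   d-geodesic from u to v is unique, the squeeze forces limits of points of Gn to
   lie on it. *)

(** * Time order and geodesics *)

Lemma adde_gtNy (R : realType) (x y : \bar R) :
  (-oo < x + y)%E -> (-oo < x)%E /\ (-oo < y)%E.
Proof. by case: x => [x||]; case: y => [y||]; rewrite ?ltxx ?ltNyr. Qed.

Section TimeOrder.
Context {R : realType}.
Implicit Types p q r : plane R.

Lemma time_lexx p : time_le p p.
Proof. by right; split. Qed.

Lemma time_le_anti p q : time_le p q -> time_le q p -> p = q.
Proof.
case: p q => [x s] [y t]; rewrite /time_le/=.
case=> [st|[-> xy]]; case=> [ts|[? yx]]; try (exfalso; lra).
by congr pair; lra.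
Qed.

Lemma time_le_trans q p r : time_le p q -> time_le q r -> time_le p r.
Proof. by rewrite /time_le; case=> [?|[? ?]]; case=> [?|[? ?]]; lra. Qed.

Lemma time_le_total p q : time_le p q \/ time_le q p.
Proof. by rewrite /time_le; lra. Qed.

Lemma time_le_snd p q : time_le p q -> p.2 <= q.2.
Proof. by case=> [/ltW//|[->]]. Qed.

Lemma nle_time_lt p q : ~ time_le p q -> time_lt q p.
Proof.
move=> npq; have [//|qp] := time_le_total p q.
by split=> // qp'; apply: npq; rewrite qp'; exact: time_lexx.
Qed.

End TimeOrder.

Section Geodesics.
Context {R : realType}.
Implicit Types (d : plane R -> plane R -> \bar R) (p q e : plane R)
  (A B G : set (plane R)).

(** Satisfied both by every [dn n] and by a spacetime metric, so that the lemmas on geodesics apply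
    to all of them. *)
Definition causal d : Prop :=
  directed_metric_neg d /\ forall p q, time_lt q p -> d p q = -oo%E.

(** For a causal [d] with [d p q] above -oo, this says that [e] lies on some geodesic from [p] to
    [q]. As an inequality between values of [d] it passes to limits. *)
Definition between d p q e : Prop := (d p q <= d p e + d e q)%E.

Definition time_geodesic_set d p q A : Prop :=
  [/\ (-oo < d p q)%E, A p, A q,
      forall a, A a -> time_le p a /\ time_le a q
    & forall a b c, A a -> A b -> A c -> time_le a b -> time_le b c ->
        d a c = (d a b + d b c)%E].

Lemma causal_time_le d p q : causal d -> (-oo < d p q)%E -> time_le p q.
Proof.
move=> [_ dlt] pq; apply: contrapT => /nle_time_lt /dlt pqE.
by rewrite pqE ltxx in pq.
Qed.

(** If a compatible order puts [a] before [b], then [d a b] is a summand of [d p q], hence above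
    -oo, and [time_le a b] follows. A total order contained in an antisymmetric one coincides with
    it on [A]. *)
Lemma geodesic_setE d p q A :
  causal d -> geodesic_set d p q A <-> time_geodesic_set d p q A.
Proof.
move=> cd; split=> [[pq Ap Aq [le [[lexx leanti letr letot] lep leq led]]]|].
  have leT a b : A a -> A b -> le a b -> time_le a b.
    move=> Aa Ab ab; apply: (causal_time_le cd).
    have := led _ _ _ Ap Aa Aq (lep _ Aa) (leq _ Aa).
    rewrite (led _ _ _ Aa Ab Aq ab (leq _ Ab)).
    by move=> dE; move: pq; rewrite dE => /adde_gtNy[_ /adde_gtNy[]].
  have Tle a b : A a -> A b -> time_le a b -> le a b.
    move=> Aa Ab ab; have [//|ba] := letot _ _ Aa Ab.
    by rewrite (time_le_anti ab (leT _ _ Ab Aa ba)); exact: lexx.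
  split=> // [a Aa|a b c Aa Ab Ac ab bc].
    by split; apply: leT => //; [exact: lep|exact: leq].
  by apply: led => //; exact: Tle.
move=> [pq Ap Aq Apq Ad]; split=> //; exists time_le; split=> //.
- split=> [a _|a b _ _|a b c _ _ _|a b _ _].
  + exact: time_lexx.
  + exact: time_le_anti.
  + exact: time_le_trans.
  + exact: time_le_total.
- by move=> a /Apq[].
- by move=> a /Apq[].
Qed.

Lemma between_dgt d p q e : (-oo < d p q)%E -> between d p q e ->
  (-oo < d p e)%E /\ (-oo < d e q)%E.
Proof.
by move=> pq /(lt_le_trans pq)/adde_gtNy.
Qed.

Lemma between_eq d p q e : causal d -> between d p q e ->
  d p q = (d p e + d e q)%E.
Proof. by move=> [[_ _ dtri] _] pqe; apply/eqP; rewrite eq_le pqe dtri. Qed.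

Lemma geodesic_set_between d p q e : causal d -> (-oo < d p q)%E ->
  between d p q e -> time_geodesic_set d p q [set x | [\/ x = p, x = e | x = q]].
Proof.
move=> cd pq pqe; have [pe eq] := between_dgt pq pqe.
have {}pe := causal_time_le cd pe; have {}eq := causal_time_le cd eq.
have {}pqe := between_eq cd pqe.
have [[_ d0 _] _] := cd.
split=> //; [exact: Or31|exact: Or33| |].
  move=> a [->|->|->]; split=> //; try exact: time_lexx.
    exact: time_le_trans eq.
  exact: time_le_trans eq.
move=> a b c Aa Ab Ac ab bc.
have [->|anb] := pselect (a = b); first by rewrite d0 add0e.
have [->|bnc] := pselect (b = c); first by rewrite d0 adde0.
(* Chains with a repeated point are settled by [d0]; the only chain of three distinct points is [p],
   [e], [q]. *)
have [[-> -> ->]//|abc] := pselect ([/\ a = p, b = e & c = q]).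
exfalso.
have ac := time_le_trans ab bc.
have anc : a <> c by move=> acE; apply: anb; apply: time_le_anti => //; rewrite acE.
case: Aa Ab Ac => aE [] bE [] cE; subst a b c; try tauto;
  try (by apply: anb; exact: time_le_anti);
  try (by apply: bnc; exact: time_le_anti);
  try (by apply: anc; exact: time_le_anti);
  try (by apply: abc; split).
Qed.

(* Zorn's lemma is applied to the sets X for which A `|` X is a geodesic set, so
   that the empty chain is not special. *)
Lemma geodesic_extend d p q A : causal d -> geodesic_set d p q A ->
  exists2 G, geodesic d p q G & A `<=` G.
Proof.
move=> cd gA.
pose P X := geodesic_set d p q (A `|` X).
have [F FP Ftot|X [PX Xmax]] := @Zorn_bigcup _ P; last first.
  exists (A `|` X); last exact: subsetUl.
  split=> // B gB AXB; apply/seteqP; split=> //.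
  apply: contrapT => nBX; apply: (Xmax B).
    split; first by move=> x Xx; apply: AXB; right.
    by move=> BX; apply: nBX => x /BX; right.
  by rewrite /P setUidr// => x Ax; apply: AXB; left.
(* The empty set joins the chain to account for the points of [A] itself; any three points of the
   union then lie in one geodesic set. *)
have F2 X Y : X = set0 \/ F X -> Y = set0 \/ F Y ->
    exists2 Z, Z = set0 \/ F Z & X `<=` Z /\ Y `<=` Z.
  move=> [->|FX] [->|FY].
  - by exists set0; [left|split].
  - by exists Y; [right|split].
  - by exists X; [right|split].
  - have [XY|YX] := Ftot _ _ FX FY; first by exists Y; [right|split].
    by exists X; [right|split].
have FA a : (A `|` \bigcup_(X in F) X) a ->
    exists2 X, X = set0 \/ F X & (A `|` X) a.
  move=> [Aa|[X FX Xa]]; first by exists set0; left.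
  by exists X; right.
have FG X : X = set0 \/ F X -> time_geodesic_set d p q (A `|` X).
  by move=> [->|/FP ?]; apply/(geodesic_setE p q _ cd) => //; rewrite setU0.
have [pq Ap Aq _] := gA.
apply: (geodesic_setE _ _ _ cd).2; split=> //; [by left|by left| |].
  by move=> a /FA[X /FG[_ _ _ Xpq _] /Xpq].
move=> a b c /FA[X FX Xa] /FA[Y FY Yb] /FA[Z FZ Zc].
have [V FV [XV YV]] := F2 _ _ FX FY; have [W /FG[_ _ _ _ +] [VW ZW]] := F2 _ _ FV FZ.
by apply; [apply: setUS Xa|apply: setUS Yb|apply: setUS Zc] => //; apply: subset_trans VW.
Qed.

Lemma geodesic_through d p q e : causal d -> (-oo < d p q)%E ->
  between d p q e -> exists2 G, geodesic d p q G & G e.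
Proof.
move=> cd pq /(geodesic_set_between cd pq) /(geodesic_setE p q _ cd).
by move=> /(geodesic_extend cd)[G gG AG]; exists G => //; apply: AG; exact: Or32.
Qed.

Lemma geodesicP d p q G : causal d -> geodesic d p q G ->
  time_geodesic_set d p q G.
Proof. by move=> cd [/(geodesic_setE p q _ cd)]. Qed.

Lemma geodesic_sub_between d p q G e : causal d -> geodesic d p q G -> G e ->
  between d p q e.
Proof.
move=> cd /(geodesicP cd)[pq Gp Gq Gpq Gd] Ge; have [pe eq] := Gpq _ Ge.
by rewrite /between (Gd p e q).
Qed.

Lemma spacetime_causal d : spacetime_metric d -> causal d.
Proof.
move=> [dm _ [_ _ dninf] _ _]; split=> // p q [qp nqp].
apply: dninf; first by move=> pq; apply: nqp.
by rewrite /R4up/=; case: qp => [|[-> _]]; rewrite ?ltxx// => /ltW; rewrite leNgt => /negP.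
Qed.

End Geodesics.

(** * Geodesics as monotone curves, and their intermediate values *)

Section Curves.
Context {R : realType}.
Implicit Types (d : plane R -> plane R -> \bar R) (p q e : plane R)
  (A B G : set (plane R)) (c g : R -> plane R).

Definition monotone_curves d : Prop :=
  forall p q G, geodesic d p q G -> monotone_curve_image G.

Let clamp (t : R) : R := Num.max 0 (Num.min t 1).

Let clamp01 t : clamp t \in `[0, 1].
Proof. by rewrite /clamp in_itv/= !(le_max, ge_max, ge_min) !lexx ler01 orbT. Qed.

Let clampE t : 0 <= t -> t <= 1 -> clamp t = t.
Proof. by move=> t0 t1; rewrite /clamp (min_idPl t1) (max_idPr t0). Qed.

Let clamp_homo s t : s <= t -> clamp s <= clamp t.
Proof.
move=> st; have mst : Num.min s 1 <= Num.min t 1.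
  by rewrite le_min !ge_min st lexx orbT.
by rewrite /clamp ge_max !le_max lexx mst orbT.
Qed.

Let clamp_continuous : continuous clamp.
Proof.
move=> t; apply/cvgrPdist_lt => e e0; near=> s.
have : `|t - s| < e by near: s; exact: (nbhsx_ballx t e e0).
rewrite /clamp !ltr_norml => /andP[? ?].
by case: (leP t 1) => ?; case: (leP s 1) => ?; rewrite ?(max_idPr (@ler01 R));
  try case: (leP 0 t) => ?; try case: (leP 0 s) => ?; lra.
Unshelve. all: by end_near. Qed.

(* The curve is parametrized by the whole line, which avoids continuity within
   a segment. *)
Lemma geodesic_curve d p q G : causal d -> monotone_curves d ->
  geodesic d p q G ->
  exists c, [/\ continuous c, c 0 = p, c 1 = q, c @` `[0, 1]%classic = G
              & forall s t, s <= t -> time_le (c s) (c t)].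
Proof.
move=> cd cG gG; have [c [cc cGE cle]] := cG _ _ _ gG.
have [pq Gp Gq Gpq _] := geodesicP cd gG.
have cG' t : 0 <= t -> t <= 1 -> G (c t).
  by move=> t0 t1; rewrite -cGE; exists t => //=; rewrite in_itv/= t0.
exists (c \o clamp); split => /=.
- move=> t; apply: (@cvg_comp _ _ _ clamp c _ (within `[0, 1]%classic (nbhs (clamp t)))).
    move=> A; rewrite /within/= => wA.
    have /= cA := clamp_continuous wA.
    have : nbhs t (fun s => clamp s \in `[0, 1] -> A (clamp s)) by exact: cA.
    by apply: filterS => s; apply; exact: clamp01.
  by have /subspace_continuousP := cc; apply; exact: clamp01.
(* The curve reaches [p] at some parameter [s >= 0], so [c 0] is not after [p]; and [p] is the least
   point of [G]. *)
- rewrite clampE//; have : G p by []; rewrite -{1}cGE => -[s /=].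
  rewrite in_itv/= => /andP[s0 s1] sp.
  apply: time_le_anti; first by rewrite -[X in time_le _ X]sp; exact: cle.
  by apply: (Gpq _ _).1; exact: cG'.
- rewrite clampE//; have : G q by []; rewrite -{1}cGE => -[s /=].
  rewrite in_itv/= => /andP[s0 s1] sq.
  apply: time_le_anti; last by rewrite -[X in time_le X _]sq; exact: cle.
  by apply: (Gpq _ _).2; exact: cG'.
- rewrite -cGE; apply/seteqP; split=> _ [t /= t01 <-].
    by exists (clamp t) => //; exact: clamp01.
  by exists t => //=; move: t01; rewrite in_itv/= => /andP[? ?]; rewrite clampE.
- move=> s t /clamp_homo st; apply: cle => //.
    by have := clamp01 s; rewrite in_itv/= => /andP[].
  by have := clamp01 t; rewrite in_itv/= => /andP[].
Qed.

Lemma curve_fst c : continuous c -> continuous (fun t => (c t).1).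
Proof. by move=> cc t; apply: (cvg_comp _ _ (cc t)); exact: cvg_fst. Qed.

Lemma curve_snd c : continuous c -> continuous (fun t => (c t).2).
Proof. by move=> cc t; apply: (cvg_comp _ _ (cc t)); exact: cvg_snd. Qed.

Lemma curve_ivt (f : R -> R) (s t m : R) : continuous f ->
  s <= t -> Num.min (f s) (f t) <= m <= Num.max (f s) (f t) ->
  exists2 r, s <= r <= t & f r = m.
Proof.
move=> fc st fm; have [|r + rm] := IVT st _ fm.
  by apply: continuous_subspaceT => x; exact: fc.
by rewrite in_itv/= => rst; exists r.
Qed.

Lemma geodesic_ivt_space d p q G a b m : causal d -> monotone_curves d ->
  geodesic d p q G -> G a -> G b ->
  Num.min a.1 b.1 <= m <= Num.max a.1 b.1 ->
  exists2 e, G e & e.1 = m /\ Num.min a.2 b.2 <= e.2 <= Num.max a.2 b.2.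
Proof.
move=> cd cG /(geodesic_curve cd cG)[c [cc _ _ <- cle]].
move=> [s + <-] [t + <-]; rewrite /= !in_itv/= => /andP[s0 s1] /andP[t0 t1].
wlog st : s t s0 s1 t0 t1 / s <= t.
  move=> wh; have [st|/ltW ts] := leP s t; first exact: (wh s t).
  by rewrite minC maxC (minC _ (c t).2) (maxC _ (c t).2); exact: (wh t s).
move=> /(curve_ivt (curve_fst cc) st)[r /andP[sr rt] rm].
exists (c r); first by exists r => //=; rewrite in_itv/=; apply/andP; split; lra.
split=> //; rewrite ge_min le_max.
by rewrite (time_le_snd (cle _ _ sr)) (time_le_snd (cle _ _ rt)) orbT.
Qed.

Lemma geodesic_ivt_time d p q G (r : R) : causal d -> monotone_curves d ->
  geodesic d p q G -> p.2 <= r <= q.2 -> exists2 e, G e & e.2 = r.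
Proof.
move=> cd cG /(geodesic_curve cd cG)[c [cc c0 c1 <- cle]] prq.
have [||t /andP[t0 t1] tr] := @curve_ivt (fun t => (c t).2) 0 1 r (curve_snd cc).
  by [].
  by rewrite /= c0 c1 ge_min le_max; case/andP: prq => -> ->; rewrite orbT.
by exists (c t) => //; exists t => //=; rewrite in_itv/= t0.
Qed.

End Curves.

(** * Crossings of curves *)

Section Crossing.
Context {R : realType}.
Implicit Types (d : plane R -> plane R -> \bar R) (p q e : plane R)
  (L G : set (plane R)) (c g : R -> plane R).

(** At the time of [g r], the curve [c] has a point weakly to the left of [g r] if [sg] is positive,
    to the right if it is negative. As [c] may stay at one time for a while, both can hold. *)
Let on_side c g (sg r : R) : Prop := exists2 t : R, 0 <= t <= 1 &
  (c t).2 = (g r).2 /\ sg * (c t).1 <= sg * (g r).1.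

(** The set is the projection of a compact set of pairs of parameters [(r, t)] of [g] and [c]. *)
Let on_side_closed c g sg s s' : continuous c -> continuous g ->
  closed [set r | s <= r <= s' /\ on_side c g sg r].
Proof.
move=> cc cg.
pose K := [set x : R * R | `[s, s']%classic x.1 /\ `[0, 1]%classic x.2].
pose f (x : R * R) := (c x.2).2 - (g x.1).2.
pose h (x : R * R) := sg * (c x.2).1 - sg * (g x.1).1.
have fst_c : continuous (fun x : R * R => x.1) by move=> x; exact: cvg_fst.
have snd_c : continuous (fun x : R * R => x.2) by move=> x; exact: cvg_snd.
have f_c : continuous f.
  move=> x; apply: cvgB.
    exact: (cvg_comp _ _ (snd_c x) (curve_snd cc (x := x.2))).
  exact: (cvg_comp _ _ (fst_c x) (curve_snd cg (x := x.1))).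
have h_c : continuous h.
  move=> x; apply: cvgB; (apply: cvgM; first exact: cvg_cst).
    exact: (cvg_comp _ _ (snd_c x) (curve_fst cc (x := x.2))).
  exact: (cvg_comp _ _ (fst_c x) (curve_fst cg (x := x.1))).
have Kc : compact (K `&` (f @^-1` [set 0] `&` h @^-1` [set x | x <= 0])).
  apply: compact_closedI; first by apply: compact_setX; exact: segment_compact.
  apply: closedI.
    by apply: (proj1 (continuous_closedP _)) => //; exact: closed_eq.
  by apply: (proj1 (continuous_closedP _)) => //; exact: closed_le.
have -> : [set r | s <= r <= s' /\ on_side c g sg r] =
    fst @` (K `&` (f @^-1` [set 0] `&` h @^-1` [set x | x <= 0])).
  apply/seteqP; split=> [r /= [rs [t t01 [cg2 cg1]]]|_ [[r t] /= + <-]].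
    exists (r, t) => //=; rewrite /K /f /h/= !in_itv/=; split=> //.
    by rewrite cg2 subrr; split=> //; rewrite subr_le0.
  rewrite /K /f /h/= !in_itv/= => -[[rs t01] [/subr0_eq fE hE]].
  by split=> //; exists t => //; split=> //; rewrite -subr_le0.
apply: compact_closed; first exact: Rhausdorff.
by apply: continuous_compact Kc; apply: continuous_subspaceT => x; exact: cvg_fst.
Qed.

(** Between the two parameters the time of [c] is constant by monotonicity, while its spatial
    coordinate passes through that of [g r]. *)
Let on_side_meet c g sg r : continuous c -> sg != 0 ->
  (forall s t, s <= t -> (c s).2 <= (c t).2) ->
  on_side c g sg r -> on_side c g (- sg) r -> exists2 t, 0 <= t <= 1 & c t = g r.
Proof.
move=> cc sg0 cle [t /andP[t0 t1] [ct2 ct1]] [t' /andP[t'0 t'1] [ct'2 ct'1]].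
have [||x tx xE] := @curve_ivt _ (fun t => (c t).1) (Num.min t t') (Num.max t t')
    (g r).1 (curve_fst cc).
- by rewrite ge_min le_max lexx.
- have : Num.min (c t).1 (c t').1 <= (g r).1 <= Num.max (c t).1 (c t').1.
    move: ct1 ct'1; rewrite !mulNr lerN2; case/orP: (lt_total sg0) => sg0'.
      by rewrite !ler_nM2l// => h1 h2; rewrite ge_min le_max h1 h2 !orbT.
    by rewrite !ler_pM2l// => h1 h2; rewrite ge_min le_max h1 h2 !orbT.
  by have [tt'|/ltW tt'] := leP t t'; rewrite // minC maxC.
- have /andP[m1 m2] : 0 <= x <= 1.
    case/andP: tx; rewrite ge_min le_max => /orP[]? /orP[]?; apply/andP; split; lra.
  exists x; first by rewrite m1.
  case/andP: tx => /cle mx /cle xm.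
  rewrite [LHS]surjective_pairing [RHS]surjective_pairing xE; congr pair.
  by move: mx xm; have [_|_] := leP t t'; rewrite ?ct2 ?ct'2; lra.
Qed.

(** If the curves never met, the parameters on one side and those on the other would be disjoint
    closed sets covering [[s, s']], both nonempty, against connectedness. *)
Let crossing c g sg s s' : continuous c -> continuous g -> sg != 0 ->
  (forall s t, s <= t -> (c s).2 <= (c t).2) -> s <= s' ->
  (forall r, s <= r <= s' -> (c 0).2 <= (g r).2 <= (c 1).2) ->
  on_side c g sg s -> on_side c g (- sg) s' ->
  exists2 r, s <= r <= s' & exists2 t, 0 <= t <= 1 & c t = g r.
Proof.
move=> cc cg sg0 cle ss' cgc S S'; apply: contrapT => nmeet.
pose B := [set r | s <= r <= s' /\ on_side c g sg r].
have BE : B = `[s, s']%classic.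
  apply: (@segment_connected _ s s') => /=.
  - by exists s; rewrite /B/= lexx.
  - exists (~` [set r | s <= r <= s' /\ on_side c g (- sg) r]).
      by apply: closed_openC; exact: on_side_closed.
    apply/seteqP; split=> r /=; rewrite in_itv/= => -[rs].
      move=> Sr; split=> // -[_ S'r]; apply: nmeet; exists r => //.
      exact: on_side_meet S'r.
    move=> nS'; split=> //.
    have [|t t01 ct] := @curve_ivt _ (fun t => (c t).2) 0 1 (g r).2 (curve_snd cc) ler01.
      by rewrite ge_min le_max; case/andP: (cgc _ rs) => -> ->; rewrite orbT.
    exists t => //; split=> //; rewrite leNgt; apply/negP => lt.
    apply: nS'; split=> //; exists t => //; split=> //.
    by rewrite !mulNr lerN2 ltW.
  - exists B; first exact: on_side_closed.
    by apply/seteqP; split=> [r Br|r [_ Br]]//; split=> //=; rewrite in_itv/=; case: Br.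
have [_ Ss'] : B s' by rewrite BE/= in_itv/= ss' lexx.
apply: nmeet; exists s'; first by rewrite ss' lexx.
exact: on_side_meet S'.
Qed.

(* A point of G on the wrong side of L lies between two crossings of G and L, so
   that the triangle inequality through the crossings puts it between p and q. *)
Lemma geodesic_barrier d sg p q u v L G : causal d -> monotone_curves d ->
  sg != 0 -> geodesic d p q L -> geodesic d u v G -> p.2 <= u.2 -> v.2 <= q.2 ->
  (forall l, L l -> l.2 = u.2 -> sg * l.1 <= sg * u.1) ->
  (forall l, L l -> l.2 = v.2 -> sg * l.1 <= sg * v.1) ->
  forall e, G e ->
  exists2 l, between d p q l & l.2 = e.2 /\ sg * l.1 <= sg * e.1.
Proof.
move=> cd cvd sg0 gL gG pu vq Lu Lv e Ge.
(* Either [L] itself supplies [l], or all of [L] at the time of [e] is strictly on the other side;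
   then [l] is [e]. *)
have [[l Ll le]|nl] := pselect (exists2 l, L l & l.2 = e.2 /\ sg * l.1 <= sg * e.1).
  by exists l => //; exact: geodesic_sub_between Ll.
exists e; last by split.
have [pq Lp Lq Lpq Ld] := geodesicP cd gL.
have [uv Gu Gv Guv Gd] := geodesicP cd gG.
have [c [cc c0 c1 cL cle]] := geodesic_curve cd cvd gL.
have [g [gc g0 g1 gE gle]] := geodesic_curve cd cvd gG.
have cle2 s t : s <= t -> (c s).2 <= (c t).2 by move=> /cle/time_le_snd.
have gle2 s t : s <= t -> (g s).2 <= (g t).2 by move=> /gle/time_le_snd.
have [r + rE] : exists2 r, `[0, 1]%classic r & g r = e by move: Ge; rewrite -gE.
rewrite /= in_itv/= => /andP[r0 r1].
have uG a : G a -> u.2 <= a.2 by move=> /Guv[/time_le_snd].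
have vG a : G a -> a.2 <= v.2 by move=> /Guv[_ /time_le_snd].
have Gg s : 0 <= s <= 1 -> G (g s).
  by move=> s01; rewrite -gE; exists s => //=; rewrite in_itv.
have time_in s : 0 <= s <= 1 -> (c 0).2 <= (g s).2 <= (c 1).2.
  by move=> /Gg Gs; rewrite c0 c1 (le_trans pu (uG _ Gs)) (le_trans (vG _ Gs) vq).
have slice s : 0 <= s <= 1 -> exists2 l, L l & l.2 = (g s).2.
  by move=> /time_in; rewrite c0 c1; exact: (geodesic_ivt_time cd cvd gL).
have sideP s k : (exists2 l, L l & l.2 = (g s).2 /\ k * l.1 <= k * (g s).1) ->
    on_side c g k s.
  by move=> [l + le]; rewrite -cL => -[t + tl]; rewrite /= in_itv/= => t01;
     exists t => //; rewrite tl.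
have S0 : on_side c g sg 0.
  have [|l Ll lu] := slice 0; first by rewrite lexx ler01.
  by apply: sideP; exists l => //; split=> //; rewrite g0; apply: Lu; rewrite // lu g0.
have S1 : on_side c g sg 1.
  have [|l Ll lv] := slice 1; first by rewrite lexx ler01.
  by apply: sideP; exists l => //; split=> //; rewrite g1; apply: Lv; rewrite // lv g1.
have Sr : on_side c g (- sg) r.
  have [|l Ll lr] := slice r; first by rewrite r0.
  apply: sideP; exists l => //; split=> //; rewrite rE !mulNr lerN2 ltW// ltNge.
  by apply/negP => lee; apply: nl; exists l => //; rewrite lr rE.
(* The side changes between the start of [G] and [e], and again between [e] and the end of [G]: this
   gives crossings [g s] before and [g s'] after [e]. *)
have [s /andP[s0 sr] [t t01 ts]] : exists2 s, 0 <= s <= r &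
    exists2 t, 0 <= t <= 1 & c t = g s.
  apply: (crossing cc gc sg0) => // s /andP[s0 sr].
  by apply: time_in; rewrite s0 (le_trans sr).
have [s' /andP[rs' s'1] [t' t'01 ts']] : exists2 s, r <= s <= 1 &
    exists2 t, 0 <= t <= 1 & c t = g s.
  apply: (crossing (sg := - sg) cc gc) => //; first by rewrite oppr_eq0.
    by move=> s' /andP[rs' s'1]; apply: time_in; rewrite s'1 (le_trans r0).
  by rewrite opprK.
have Ls : L (g s) by rewrite -cL -ts; exists t => //=; rewrite in_itv.
have Ls' : L (g s') by rewrite -cL -ts'; exists t' => //=; rewrite in_itv.
have [ps sq] := Lpq _ Ls; have [ps' s'q] := Lpq _ Ls'.
have [[_ _ tri] _] := cd.
have re : time_le (g s) e by rewrite -rE; exact: gle.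
have er : time_le e (g s') by rewrite -rE; exact: gle.
have Gs : G (g s) by apply: Gg; rewrite s0 (le_trans sr).
have Gs' : G (g s') by apply: Gg; rewrite s'1 andbT (le_trans r0).
(* Split [d p q] along [L] at both crossings, split the middle piece along [G] at [e], and recombine
   the outer pairs by the triangle inequality. *)
rewrite /between (Ld p (g s) q)// (Ld (g s) (g s') q)//; last exact: time_le_trans er.
rewrite (Gd (g s) e (g s'))// -addeA [leLHS]addeA.
by apply: leeD; exact: tri.
Qed.

End Crossing.

(** * Limits along ultrafilters *)

Section Ultrafilters.

Lemma near_choice (I T : Type) (F : set_system I) (P : I -> T -> Prop) :
  T -> Filter F -> (\forall i \near F, exists x, P i x) ->
  exists f : I -> T, \forall i \near F, P i (f i).
Proof.
move=> t0 FF FP.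
have /choice[f fP] : forall i, exists y, (exists x, P i x) -> P i y.
  by move=> i; have [[x Px]|nP] := pselect (exists x, P i x); [exists x|exists t0].
by exists f; apply: filterS FP => i; exact: fP.
Qed.

(** If [P] did not hold near [F], the trace of [F] on the complement of [P] would be proper and
    extend to an ultrafilter. Eventual statements thus reduce to ultrafilters, along which points of
    a compact set converge without passing to subsequences. *)
Lemma ultra_near (I : Type) (F : set_system I) (P : I -> Prop) : Filter F ->
  (forall U, UltraFilter U -> F `<=` U -> \forall i \near U, P i) ->
  \forall i \near F, P i.
Proof.
move=> FF UP; apply: contrapT => nFP.
have PF : ProperFilter (within (~` [set i | P i]) F).
  split; last exact: within_filter.
  rewrite /within/= => FnP; apply: nFP.
  have : F [set i | (~` [set i | P i]) i -> False] by exact: FnP.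
  by apply: filterS => i /=; exact: contrapT.
have [U [UU FU]] := ultraFilterLemma PF.
have UnP : U (~` [set i | P i]) by apply: FU; exact: withinT.
have [|i []//] := filter_ex (filterI (UP U UU _) UnP).
by move=> A FA; apply: FU; apply: filterS FA.
Qed.

Lemma ultra_fmap (I T : Type) (U : set_system I) (f : I -> T) :
  UltraFilter U -> UltraFilter (f @ U).
Proof.
move=> UU; split; first exact: fmap_proper_filter.
move=> G PG fUG; apply/seteqP; split=> A; last exact: fUG.
move=> GA; have [//|UnA] := in_ultra_setVsetC (f @^-1` A) UU.
have : G set0 by rewrite -(setICr A); apply: filterI GA _; exact: fUG.
by move=> /filter_ex[].
Qed.

Lemma ultra_compact (I : Type) (T : topologicalType) (U : set_system I)
    (K : set T) (f : I -> T) : UltraFilter U -> compact K ->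
  (\forall i \near U, K (f i)) -> exists2 x, K x & f @ U --> x.
Proof.
move=> UU + UK; rewrite compact_ultra => /(_ (f @ U) (ultra_fmap f UU) UK).
by move=> [x [Kx fx]]; exists x.
Qed.

(** Turns witnesses in a compact set into a convergent family; most arguments by contradiction below
    apply it to counterexamples. *)
Lemma ultra_select (I : Type) (T : topologicalType) (U : set_system I)
    (K : set T) (P : I -> T -> Prop) : UltraFilter U -> compact K ->
  (\forall i \near U, exists2 x, K x & P i x) ->
  exists (f : I -> T) (x : T),
    [/\ K x, f @ U --> x & \forall i \near U, P i (f i)].
Proof.
move=> UU cK UP; have [i [t0 _ _]] := filter_ex UP.
have [|f fP] := @near_choice I T U (fun i x => K x /\ P i x) t0 _.
  by apply: filterS UP => j [x Kx Px]; exists x.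
have [|x Kx fx] := ultra_compact UU cK (f := f); first by apply: filterS fP => j [].
by exists f, x; split=> //; apply: filterS fP => j [].
Qed.

Lemma ultra_not (I : Type) (U : set_system I) (P : I -> Prop) : UltraFilter U ->
  ~ (\forall i \near U, P i) -> \forall i \near U, ~ P i.
Proof. by move=> UU nP; have [//|] := in_ultra_setVsetC [set i | P i] UU. Qed.

End Ultrafilters.

(** * Upper and lower limits of the metrics, and limits of betweenness *)

Section Limits.
Context {R : realType} {I : Type}.
Implicit Types (U : set_system I) (D : I -> plane R -> plane R -> \bar R)
  (d : plane R -> plane R -> \bar R) (p q e : plane R).

(* The upper half of hypograph convergence, along a filter. *)
Definition limsup_le U D d : Prop :=
  forall (a_ b_ : I -> plane R) a b, a_ @ U --> a -> b_ @ U --> b -> a <> b ->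
  forall M : R, (d a b < M%:E)%E -> \forall i \near U, (D i (a_ i) (b_ i) < M%:E)%E.

(** The lower half, stated for given [p_] and [q_]: hypograph convergence provides it along suitable
    sequences only, the good pairs. *)
Definition liminf_ge U D (p_ q_ : I -> plane R) (l : \bar R) : Prop :=
  forall M : R, (M%:E < l)%E -> \forall i \near U, (M%:E < D i (p_ i) (q_ i))%E.

Lemma lte_dense_fin (x z : \bar R) : (x < z)%E ->
  exists c : R, (x < c%:E)%E /\ (c%:E < z)%E.
Proof.
case: x z => [x||] [z||]//.
- by rewrite lte_fin => xz; exists ((x + z) / 2); rewrite !lte_fin !midf_lt.
- by move=> _; exists (x + 1); rewrite ltry lte_fin ltrDl.
- by move=> _; exists (z - 1); rewrite ltNyr lte_fin ltrBlDr ltrDl.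
- by move=> _; exists 0; rewrite ltry ltNyr.
Qed.

Lemma adde_lt_split (x y z : \bar R) : (x < +oo)%E -> (y < +oo)%E ->
  (x + y < z)%E ->
  exists a b : R, [/\ (x < a%:E)%E, (y < b%:E)%E & ((a + b)%:E < z)%E].
Proof.
move=> xoo yoo /lte_dense_fin[c [+ cz]].
suff xyc : (x + y < c%:E)%E -> exists a b : R,
    [/\ (x < a%:E)%E, (y < b%:E)%E & a + b = c].
  by move=> /xyc[a [b [xa yb abc]]]; exists a, b; rewrite abc.
move=> {z cz}; case: x y xoo yoo => [x||] [y||]// _ _.
- rewrite -EFinD lte_fin => xyc.
  by exists (x + (c - x - y) / 2), (y + (c - x - y) / 2); rewrite !lte_fin; split; lra.
- by move=> _; exists (x + 1), (c - x - 1); rewrite lte_fin ltNyr; split=> //; lra.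
- by move=> _; exists (c - y - 1), (y + 1); rewrite lte_fin ltNyr; split=> //; lra.
- by move=> _; exists 0, c; rewrite !ltNyr add0r.
Qed.

(** Otherwise reals [a > d p e] and [b > d e q] exist with [a + b < d p q]. Then [a] and [b]
    eventually bound the two pieces from above while [D] along the good pair exceeds [a + b]. The
    points must be distinct because [limsup_le] concerns pairs off the diagonal. *)
Lemma between_lim U D d (p_ q_ e_ : I -> plane R) p q e : ProperFilter U ->
  (forall a b, (d a b < +oo)%E) -> limsup_le U D d ->
  liminf_ge U D p_ q_ (d p q) ->
  p_ @ U --> p -> q_ @ U --> q -> e_ @ U --> e -> p <> e -> e <> q ->
  (\forall i \near U, between (D i) (p_ i) (q_ i) (e_ i)) -> between d p q e.
Proof.
move=> PU dfin Dd pq pp qq ee pe eq Ub; rewrite /between leNgt; apply/negP.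
move=> /(adde_lt_split (dfin _ _) (dfin _ _))[a [b [pea eqb abpq]]].
have Upe := Dd _ _ _ _ pp ee pe _ pea; have Ueq := Dd _ _ _ _ ee qq eq _ eqb.
have [i [[[]]]] := filter_ex (filterI (filterI (filterI Upe Ueq) Ub) (pq _ abpq)).
move=> i1 i2 /[swap] i3; rewrite /between leNgt => /negP; apply.
by apply: lt_trans i3; rewrite EFinD lteD.
Qed.

End Limits.

(** * Consequences of hypograph convergence *)

Section Continuity.
Context {R : realType}.
Implicit Types (d : plane R -> plane R -> \bar R) (p q e : plane R).

Lemma cvg_fst_comp (I : Type) (S T : topologicalType) (U : set_system I)
    (f : I -> S * T) (x : S * T) : Filter U -> f @ U --> x -> (f i).1 @[i --> U] --> x.1.
Proof. by move=> FU fx; apply: (cvg_comp _ _ fx); exact: cvg_fst. Qed.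

Lemma cvg_snd_comp (I : Type) (S T : topologicalType) (U : set_system I)
    (f : I -> S * T) (x : S * T) : Filter U -> f @ U --> x -> (f i).2 @[i --> U] --> x.2.
Proof. by move=> FU fx; apply: (cvg_comp _ _ fx); exact: cvg_snd. Qed.

Lemma cvg_pairP (I : Type) (S T : topologicalType) (U : set_system I)
    (f : I -> S) (g : I -> T) (x : S) (y : T) : Filter U ->
  f @ U --> x -> g @ U --> y -> (f i, g i) @[i --> U] --> (x, y).
Proof. by move=> FU; exact: cvg_pair. Qed.

Lemma R4o_open : open (@R4o R).
Proof.
have -> : @R4o R = [set r | r.1.1 - r.2.1 != 0] `|` [set r | r.1.2 - r.2.2 != 0].
  apply/seteqP; split=> -[[x s] [y t]]; rewrite /R4o/= !subr_eq0.
    move=> xsyt; have [xy|] := eqVneq x y; last by left.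
    by right; apply/eqP => st; apply: xsyt; rewrite xy st.
  by move=> [] /eqP + [xy st].
have [c1 c2] : continuous (fun r : plane R * plane R => r.1.1 - r.2.1) /\
    continuous (fun r : plane R * plane R => r.1.2 - r.2.2).
  by split=> r; apply: cvgB;
     [apply: cvg_fst_comp; exact: cvg_fst|apply: cvg_fst_comp; exact: cvg_snd
     |apply: cvg_snd_comp; exact: cvg_fst|apply: cvg_snd_comp; exact: cvg_snd].
move: c1 c2 => /continuousP c1 /continuousP c2; apply: openU;
  [exact: (c1 _ (@open_neq R 0))|exact: (c2 _ (@open_neq R 0))].
Qed.

Lemma spacetime_cvg d (I : Type) (U : set_system I) (r_ : I -> plane R * plane R)
    (r : plane R * plane R) :
  Filter U -> spacetime_metric d -> r_ @ U --> r -> R4o r ->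
  d (r_ i).1 (r_ i).2 @[i --> U] --> d r.1 r.2.
Proof.
move=> FU [_ + _ _ _] rr ro; rewrite (continuous_open_subspace _ R4o_open) => dc.
exact: (cvg_comp _ _ rr (dc r (mem_set ro))).
Qed.

Lemma cvge_near_lt (I : Type) (U : set_system I) (f : I -> \bar R) l m :
  Filter U -> f @ U --> l -> (l < m)%E -> \forall i \near U, (f i < m)%E.
Proof. by move=> FU fl lm; exact: (fl _ (open_ereal_lt' lm)). Qed.

Lemma cvge_near_gt (I : Type) (U : set_system I) (f : I -> \bar R) l m :
  Filter U -> f @ U --> l -> (m < l)%E -> \forall i \near U, (m < f i)%E.
Proof. by move=> FU fl lm; exact: (fl _ (open_ereal_gt' lm)). Qed.

(** Allows the constant family [d] in the limit lemmas, for perturbations of the endpoints alone. *)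
Lemma spacetime_limsup d (I : Type) (U : set_system I) : Filter U ->
  spacetime_metric d -> limsup_le U (fun=> d) d.
Proof.
move=> FU hd a_ b_ a b aa bb ab M dM.
have := @spacetime_cvg _ _ _ (fun i => (a_ i, b_ i)) (a, b) FU hd (cvg_pairP FU aa bb) ab.
by move=> h; exact: (cvge_near_lt FU h dM).
Qed.

Lemma spacetime_liminf d (I : Type) (U : set_system I) (p_ q_ : I -> plane R) p q :
  Filter U -> spacetime_metric d -> p_ @ U --> p -> q_ @ U --> q -> p <> q ->
  liminf_ge U (fun=> d) p_ q_ (d p q).
Proof.
move=> FU hd pp qq pq M Md.
have := @spacetime_cvg _ _ _ (fun i => (p_ i, q_ i)) (p, q) FU hd (cvg_pairP FU pp qq) pq.
by move=> h; exact: (cvge_near_gt FU h Md).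
Qed.

End Continuity.

(** * The two halves of hypograph convergence *)

Section Hypographs.
Context {R : realType}.
Implicit Types (d : plane R -> plane R -> \bar R) (p q e : plane R).

(** The factor of [contract] in [hypo_embed]. It is continuous and positive off the diagonal, so
    there the embedded height determines the height. *)
Let weight (r : plane R * plane R) : R := enorm2 (r.1 - r.2) * expR (- enorm4 r).

Let coord_cvg (I : Type) (U : set_system I) (r_ : I -> plane R * plane R)
    (r : plane R * plane R) :
  Filter U -> r_ @ U --> r ->
  [/\ (r_ i).1.1 @[i --> U] --> r.1.1, (r_ i).1.2 @[i --> U] --> r.1.2,
      (r_ i).2.1 @[i --> U] --> r.2.1 & (r_ i).2.2 @[i --> U] --> r.2.2].
Proof.
move=> FU rr; have r1 := cvg_fst_comp FU rr; have r2 := cvg_snd_comp FU rr.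
by split; [exact: cvg_fst_comp|exact: cvg_snd_comp|exact: cvg_fst_comp
          |exact: cvg_snd_comp].
Qed.

Let weight_cvg (I : Type) (U : set_system I) (r_ : I -> plane R * plane R)
    (r : plane R * plane R) :
  Filter U -> r_ @ U --> r -> weight (r_ i) @[i --> U] --> weight r.
Proof.
move=> FU /coord_cvg[c11 c12 c21 c22].
have sqr_cvg (f : I -> R) (l : R) : f @ U --> l -> f i ^+ 2 @[i --> U] --> l ^+ 2.
  by move=> fl; exact: (cvg_comp _ _ fl (@exprn_continuous R 2 l)).
have sqrt_cvg (f : I -> R) (l : R) : f @ U --> l ->
    Num.sqrt (f i) @[i --> U] --> Num.sqrt l.
  by move=> fl; exact: (cvg_comp _ _ fl (@sqrt_continuous R l)).
have exp_cvg (f : I -> R) (l : R) : f @ U --> l ->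
    expR (f i) @[i --> U] --> expR l.
  by move=> fl; exact: (cvg_comp _ _ fl (@continuous_expR R l)).
apply: cvgM; first by apply: sqrt_cvg; apply: cvgD; apply: sqr_cvg; exact: cvgB.
apply: exp_cvg; apply: cvgN; apply: sqrt_cvg.
by apply: cvgD; [apply: cvgD; [apply: cvgD|]|]; exact: sqr_cvg.
Qed.

Let weight_gt0 r : R4o r -> 0 < weight r.
Proof.
case: r => [[x s] [y t]]; rewrite /R4o/= => rne.
apply: mulr_gt0; last exact: expR_gt0.
rewrite /enorm2/= sqrtr_gt0 lt_neqAle addr_ge0 ?sqr_ge0// andbT eq_sym.
apply/eqP => e0; apply: rne.
have [x2 s2] := (sqr_ge0 (x - y), sqr_ge0 (s - t)).
have /eqP : (x - y) ^+ 2 = 0 by lra.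
have /eqP : (s - t) ^+ 2 = 0 by lra.
by rewrite !sqrf_eq0 !subr_eq0 => /eqP -> /eqP ->.
Qed.

Let le_sqrt (a b e : R) : a ^+ 2 <= b -> Num.sqrt b < e -> `|a| < e.
Proof. by move=> ab; apply: le_lt_trans; rewrite -sqrtr_sqr ler_wsqrtr. Qed.

Let edist5_ball (x y : (plane R * plane R) * R) (e : R) : edist5 x y < e ->
  ball x.1 e y.1 /\ `|x.2 - y.2| < e.
Proof.
case: x y => [[[x1 x2] [x3 x4]] x5] [[[y1 y2] [y3 y4]] y5].
rewrite /edist5 /enorm4/= sqr_sqrtr; last by rewrite !addr_ge0 ?sqr_ge0.
move=> dlt.
have [[[h1 h2] h3] h4] := (sqr_ge0 (x1 - y1), sqr_ge0 (x2 - y2), sqr_ge0 (x3 - y3),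
  sqr_ge0 (x4 - y4)).
have h5 := sqr_ge0 (x5 - y5).
have [b1 b2 b3 b4 b5] : [/\ `|x1 - y1| < e, `|x2 - y2| < e, `|x3 - y3| < e,
    `|x4 - y4| < e & `|x5 - y5| < e] by split; apply: le_sqrt dlt; lra.
exact: (conj (conj (conj b1 b2) (conj b3 b4)) b5).
Qed.

(** Closeness of embedded points carries over to base points directly, and to heights because the
    weights converge to [weight r > 0]. Lower bounds on heights are all that both halves use. *)
Let hypo_near (I : Type) (U : set_system I)
    (x_ y_ : I -> (plane R * plane R) * \bar R) (r : plane R * plane R) :
  Filter U -> R4o r -> (x_ i).1 @[i --> U] --> r ->
  (forall e : R, 0 < e -> \forall i \near U,
     edist5 (hypo_embed (x_ i)) (hypo_embed (y_ i)) < e) ->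
  (y_ i).1 @[i --> U] --> r /\
  forall k k' : R, k' < k -> (\forall i \near U, k <= contract (x_ i).2) ->
    \forall i \near U, k' < contract (y_ i).2.
Proof.
move=> FU ro xr xy.
have yr : (y_ i).1 @[i --> U] --> r.
  apply/cvg_ballP => e e0; have e20 : 0 < e / 2 by rewrite divr_gt0.
  near=> i; apply: (@ball_split _ _ (x_ i).1).
    by near: i; exact: (cvg_ball xr).
  have /edist5_ball[] : edist5 (hypo_embed (x_ i)) (hypo_embed (y_ i)) < e / 2.
    by near: i; exact: xy.
  by [].
split=> // k k' k'k xk.
have w0 := weight_gt0 ro.
have wk : weight (x_ i).1 * k - weight (y_ i).1 * k' @[i --> U] -->
    weight r * (k - k').
  by rewrite mulrBr; apply: cvgB; (apply: cvgM; [exact: weight_cvg|exact: cvg_cst]).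
have wkk : 0 < weight r * (k - k') by rewrite mulr_gt0// subr_gt0.
have e0 : 0 < weight r * (k - k') / 2 by rewrite divr_gt0.
near=> i; rewrite ltNge; apply/negP => yk'.
have wxi : 0 <= weight (x_ i).1 by rewrite mulr_ge0 ?sqrtr_ge0// expR_ge0.
have wyi : 0 <= weight (y_ i).1 by rewrite mulr_ge0 ?sqrtr_ge0// expR_ge0.
have : weight r * (k - k') / 2 < weight (x_ i).1 * k - weight (y_ i).1 * k'.
  near: i; apply: (cvgr_gt (weight r * (k - k')) wk); lra.
have /edist5_ball[_] : edist5 (hypo_embed (x_ i)) (hypo_embed (y_ i)) <
    weight r * (k - k') / 2 by near: i; exact: xy.
rewrite /hypo_embed/= -/(weight _) -/(weight _) ltr_norml => /andP[_ h1] h2.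
have h3 : weight (x_ i).1 * k <= weight (x_ i).1 * contract (x_ i).2.
  by apply: ler_wpM2l => //; near: i.
have h4 : weight (y_ i).1 * contract (y_ i).2 <= weight (y_ i).1 * k'.
  by apply: ler_wpM2l.
lra.
Unshelve. all: by end_near. Qed.

Let hypograph_near (U : set_system nat) (A B : nat -> set ((plane R * plane R) * \bar R))
    (x_ : nat -> (plane R * plane R) * \bar R) : Filter U -> \oo `<=` U ->
  (fun n => hausdorff_dist edist5 (hypo_embed @` A n) (hypo_embed @` B n))
    @ \oo --> 0%E ->
  (\forall n \near U, A n (x_ n)) ->
  exists y_ : nat -> (plane R * plane R) * \bar R,
    (\forall n \near U, B n (y_ n)) /\
    (forall e : R, 0 < e -> \forall n \near U,
       edist5 (hypo_embed (x_ n)) (hypo_embed (y_ n)) < e).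
Proof.
move=> FU oU; set h := fun n => _ => h0 Ax.
(* A real bound tending to 0: [maxe] and [fine] deal with infinite distances, and the added inverse
   makes it strictly larger than [h n]. *)
pose e_ n : R := fine (maxe (h n) 0) + n.+1%:R^-1.
have he n : (h n < 1)%E -> (h n < (e_ n)%:E)%E.
  move=> h1; have h1' : (maxe (h n) 0 < 1)%E by rewrite gt_max h1 lte01.
  have hfin : maxe (h n) 0%E \is a fin_num.
    by rewrite ge0_fin_numE ?le_max ?lexx ?orbT// (lt_le_trans h1')// leey.
  rewrite /e_ EFinD fineK//; apply: (@le_lt_trans _ _ (maxe (h n) 0%E)).
    by rewrite le_max lexx.
  by rewrite lteDl// lte_fin invr_gt0.
have [y_ yP] : exists y_ : nat -> (plane R * plane R) * \bar R,
    \forall n \near U, B n (y_ n) /\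
      edist5 (hypo_embed (x_ n)) (hypo_embed (y_ n)) < e_ n.
  apply: (near_choice (P := fun n y => B n y /\
    edist5 (hypo_embed (x_ n)) (hypo_embed y) < e_ n)).
    exact: ((point, point), 0%E).
  have h1 : \forall n \near U, (h n < 1)%E.
    by apply: oU; exact: (cvge_near_lt _ h0 lte01).
  apply: filterS2 h1 Ax => n /he; rewrite gt_max => /andP[/excess_lt[e ee Aa] _].
  move=> Axn; have [|_ [y By <-] yd] := Aa (hypo_embed (x_ n)); first by exists (x_ n).
  by exists y; split=> //; exact: lt_trans ee.
exists y_; split; first by apply: filterS yP => n [].
move=> e e0; have e20 : 0 < e / 2 by rewrite divr_gt0.
have h1 : \forall n \near U, (h n < (e / 2)%:E)%E.
  by apply: oU; apply: (cvge_near_lt _ h0); rewrite lte_fin.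
have h2 : \forall n \near U, n.+1%:R^-1 < e / 2.
  by apply: oU; exact: (near_infty_natSinv_lt (PosNum e20)).
apply: filterS3 h1 h2 yP => n h1 h2 [_ yd]; apply: (lt_le_trans yd).
have hm : (maxe (h n) 0 < (e / 2)%:E)%E by rewrite gt_max h1 lte_fin.
rewrite /e_ [leRHS]splitr; apply: lerD; last exact: ltW.
rewrite -lee_fin fineK ?ltW// ge0_fin_numE ?le_max ?lexx ?orbT//.
exact: (lt_trans hm (ltry _)).
Qed.

Let hypograph_le d x : spacetime_metric d -> hypograph d x -> (x.2 <= d x.1.1 x.1.2)%E.
Proof.
move=> hd [xcl xo]; rewrite leNgt; apply/negP => /lte_dense_fin[M [dM Mx]].
have dnear : \forall r \near nbhs x.1, (d r.1 r.2 < M%:E)%E.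
  have cv : d r.1 r.2 @[r --> nbhs x.1] --> d x.1.1 x.1.2.
    by apply: (@spacetime_cvg R d _ (nbhs x.1) id x.1) => //; exact: cvg_id.
  exact: (cvge_near_lt _ cv dM).
have [|[r m] [/= [ro rm] [dr Mm]]] := xcl [set y | (d y.1.1 y.1.2 < M%:E)%E /\ (M%:E < y.2)%E].
  apply: filterI.
    exact: (@cvg_fst _ _ (nbhs x.1) (nbhs x.2) _ _ dnear).
  exact: (@cvg_snd _ _ (nbhs x.1) (nbhs x.2) _ _ (open_ereal_gt' Mx)).
by have := lt_le_trans Mm rm; rewrite ltNge ltW.
Qed.

(** If [dn] stays at least [M] along [U], the points of height [M] over [(a_ n, b_ n)] have
    neighbours in the hypograph of [d], eventually higher than some [M'] with [d a b < M' < M]; this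
    contradicts the continuity of [d] at [(a, b)]. *)
Lemma hypo_cvg_limsup dn d U : UltraFilter U -> \oo `<=` U ->
  spacetime_metric d -> hypo_cvg dn d -> limsup_le U dn d.
Proof.
move=> UU oU hd hc a_ b_ a b aa bb ab M dM; apply: contrapT => /ultra_not nM.
have [M' [dM' M'M]] := lte_dense_fin dM.
have abr : (a_ n, b_ n) @[n --> U] --> (a, b) by exact: cvg_pairP.
pose x_ n := ((a_ n, b_ n), M%:E).
have Ro : \forall n \near U, R4o (a_ n, b_ n).
  by apply: abr; apply: open_nbhs_nbhs; split; [exact: R4o_open|].
have xh : \forall n \near U, hypograph (dn n) (x_ n).
  apply: filterS2 Ro nM => n ron /negP; rewrite -leNgt => Mdn; split=> //.
  by apply: subset_closure.
have [y_ [yh xy]] := hypograph_near (B := fun=> hypograph d) _ oU hc xh.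
have abo : R4o (a, b) by [].
have [yr yM] := hypo_near (x_ := x_) _ abo abr xy.
have kk : contract M'%:E < contract M%:E by rewrite lt_contract.
have xk : \forall n \near U, contract M%:E <= contract (x_ n).2.
  by apply: filterE => n; exact: lexx.
have yM' := yM _ _ kk xk.
have dy : \forall n \near U, (d (y_ n).1.1 (y_ n).1.2 < M'%:E)%E.
  exact: (cvge_near_lt _ (spacetime_cvg _ hd yr abo) dM').
have [n [[yhn]]] := filter_ex (filterI (filterI yh yM') dy).
rewrite lt_contract => M'y dyn.
by have := hypograph_le hd yhn; rewrite leNgt (lt_trans dyn).
Qed.

(** The good pairs are the base points of points in the hypographs of [dn] that approximate the
    point of height [d p q] over [(p, q)]. *)
Lemma hypo_cvg_liminf dn d p q : spacetime_metric d -> hypo_cvg dn d ->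
  R4up (p, q) -> exists p_ q_ : nat -> plane R,
  [/\ p_ @ \oo --> p, q_ @ \oo --> q & liminf_ge \oo dn p_ q_ (d p q)].
Proof.
move=> hd hc pq; have [_ _ [dgt _ _] _ _] := hd.
have pqo : R4o (p, q) by rewrite /R4o/= => pqE; move: pq; rewrite /R4up/= pqE ltxx.
pose x : (plane R * plane R) * \bar R := ((p, q), d p q).
have xh : hypograph d x by split=> //; apply: subset_closure.
have [|y_ [yh xy]] := @hypograph_near \oo (fun=> hypograph d) (fun n => hypograph (dn n))
    (fun=> x) _ (fun _ h => h) _ (filterE _ (fun=> xh)).
  by under eq_fun do rewrite hausdorff_distC.
have [yr yM] := hypo_near (x_ := fun=> x) _ pqo (cvg_cst _) xy.
(* A hypograph is a closure, so [y_ n] need not lie below the graph of [dn n]; it is replaced by a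
   point [z_ n] that does, at distance less than [1 / (n + 1)]. *)
have [z_ zP] : exists z_ : nat -> (plane R * plane R) * \bar R,
  \forall n \near \oo, [/\ ((z_ n).2 <= dn n (z_ n).1.1 (z_ n).1.2)%E,
    ball (y_ n).1 n.+1%:R^-1 (z_ n).1 &
    `|contract (y_ n).2 - contract (z_ n).2| < n.+1%:R^-1].
  apply: (near_choice (P := fun n (z : (plane R * plane R) * \bar R) =>
    [/\ (z.2 <= dn n z.1.1 z.1.2)%E, ball (y_ n).1 n.+1%:R^-1 z.1 &
    `|contract (y_ n).2 - contract z.2| < n.+1%:R^-1])).
    exact: x.
  apply: filterS yh => n [ycl _].
  have [|z [[_ zd] [z1 z2]]] := ycl (ball (y_ n) n.+1%:R^-1).
    by apply: nbhsx_ballx; rewrite invr_gt0.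
  by exists z; split.
have zr : (z_ n).1 @[n --> \oo] --> (p, q).
  apply/cvg_ballP => e e0; have e20 : 0 < e / 2 by rewrite divr_gt0.
  have h2 := near_infty_natSinv_lt (PosNum e20).
  near=> n; have h1n : ball (p, q) (e / 2) (y_ n).1 by near: n; exact: (cvg_ball yr).
  have h2n : n.+1%:R^-1 < e / 2 by near: n; exact: h2.
  have [_ zb _] : [/\ ((z_ n).2 <= dn n (z_ n).1.1 (z_ n).1.2)%E,
    ball (y_ n).1 n.+1%:R^-1 (z_ n).1 &
    `|contract (y_ n).2 - contract (z_ n).2| < n.+1%:R^-1] by near: n; exact: zP.
  by apply: (ball_split h1n); apply: le_ball zb; exact: ltW.
exists (fun n => (z_ n).1.1), (fun n => (z_ n).1.2); split.
- exact: cvg_fst_comp zr.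
- exact: cvg_snd_comp zr.
- move=> M Md; have kk : contract M%:E < contract (d p q) by rewrite lt_contract.
  pose k := (contract M%:E + contract (d p q)) / 2.
  have Mk : 0 < k - contract M%:E by rewrite /k; lra.
  have kd : k < contract (d p q) by rewrite /k; lra.
  have xk : \forall n \near \oo, contract (d p q) <= contract x.2.
    by near=> n; exact: lexx.
  have h1 := yM _ _ kd xk.
  have h2 := near_infty_natSinv_lt (PosNum Mk).
  near=> n; have h1n : k < contract (y_ n).2 by near: n; exact: h1.
  have h2n : n.+1%:R^-1 < k - contract M%:E by near: n; exact: h2.
  have [zd _] : [/\ ((z_ n).2 <= dn n (z_ n).1.1 (z_ n).1.2)%E,
    ball (y_ n).1 n.+1%:R^-1 (z_ n).1 &
    `|contract (y_ n).2 - contract (z_ n).2| < n.+1%:R^-1] by near: n; exact: zP.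
  rewrite ltr_norml => /andP[_ h3]; apply: lt_le_trans zd; rewrite -lt_contract.
  rewrite -subr_gt0; have h4 := lt_trans h3 h2n; move: h1n h4; clearbody k; lra.
Unshelve. all: by end_near. Qed.

End Hypographs.

(** * Compactness in the Hausdorff topology *)

Section HausdorffCompactness.
Context {R : realType}.
Implicit Types (A B : closed_set R) (x y : plane R).

Lemma edist2_ball x y (e : R) : edist2 x y < e -> ball x e y.
Proof.
case: x y => [a b] [a' b']; rewrite /edist2 /enorm2/= => lt_e.
have le_e (c : R) : c ^+ 2 <= (a - a') ^+ 2 + (b - b') ^+ 2 -> `|c| < e.
  by move=> ce; apply: le_lt_trans lt_e; rewrite -sqrtr_sqr ler_wsqrtr.
have [h1 h2] := (sqr_ge0 (a - a'), sqr_ge0 (b - b')).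
by split; apply: le_e; rewrite ?lerDl ?lerDr.
Qed.

Lemma ball_edist2 x y (e : R) : ball x (e / 2) y -> edist2 x y < e.
Proof.
case: x y => [a b] [a' b'] [/= ]; rewrite /ball/= => ae be.
rewrite /edist2 /enorm2/=.
have [h1 h2] := (normr_ge0 (a - a'), normr_ge0 (b - b')).
apply: (@le_lt_trans _ _ (`|a - a'| + `|b - b'|)); last by lra.
rewrite -[leRHS]ger0_norm ?addr_ge0// -sqrtr_sqr; apply: ler_wsqrtr.
by rewrite -(real_normK (num_real (a - a'))) -(real_normK (num_real (b - b'))); nra.
Qed.

Lemma edist2_cvg (I : Type) (U : set_system I) (f : I -> plane R) x (e : R) :
  Filter U -> f @ U --> x -> 0 < e -> \forall i \near U, edist2 x (f i) < e.
Proof.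
move=> FU fx e0; have e20 : 0 < e / 2 by rewrite divr_gt0.
by near=> i; apply: ball_edist2; near: i; exact: (cvg_ball fx).
Unshelve. all: by end_near.
Qed.

Lemma closed_edist2 A x :
  (forall e : R, 0 < e -> exists2 a, closed_set_val A a & edist2 x a < e) ->
  closed_set_val A x.
Proof.
move=> Ax; apply: (@closed_set_closed R A) => B /nbhs_ballP[e /= e0 eB].
by have [a Aa /edist2_ball/eB Ba] := Ax e e0; exists a.
Qed.

Lemma closed_set_eq A B : closed_set_val A `<=>` closed_set_val B -> A = B.
Proof.
case: A B => [A cA] [B cB] /= /seteqP AB; move: cA cB; rewrite AB => cA cB.
by congr ClosedSet; exact: Prop_irrelevance.
Qed.

Lemma ball_closed_setE A B (e : R) :
  ball A e B = (hausdorff_dist edist2 A B < e%:E)%E :> Prop.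
Proof. by []. Qed.

(** If two closed sets have a third one arbitrarily close to both, each point of one is a limit of
    points of the other. *)
Lemma closed_set_hausdorff : hausdorff_space (closed_set R).
Proof.
have sub A B : (forall e : R, 0 < e -> exists2 C : closed_set R, ball A e C & ball B e C) ->
    closed_set_val A `<=` closed_set_val B.
  move=> AB x Ax; apply: closed_edist2 => e e0.
  have [|C] := AB (e / 2); first by rewrite divr_gt0.
  rewrite !ball_closed_setE /hausdorff_dist !gt_max.
  move=> /andP[/excess_lt[e1 e1e AC] _] /andP[_ /excess_lt[e2 e2e CB]].
  have [c Cc xc] := AC _ Ax; have [b Bb cb] := CB _ Cc; exists b => //.
  by apply: le_lt_trans (edist2_triangle c _ _) _; lra.
move=> A B clAB; apply: closed_set_eq; split; apply: sub => e e0.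
  have [C [AC BC]] := clAB _ _ (nbhsx_ballx A e e0) (nbhsx_ballx B e e0).
  by exists C.
have [C [AC BC]] := clAB _ _ (nbhsx_ballx A e e0) (nbhsx_ballx B e e0).
by exists C.
Qed.

(* An ultrafilter of closed subsets of K converges to the set of the points x all
   of whose neighbourhoods meet almost all the sets. *)
Lemma blaschke (K : set (plane R)) : compact K ->
  compact [set A : closed_set R | closed_set_val A `<=` K].
Proof.
move=> cK; rewrite compact_ultra => F FU FK.
pose L := [set x | forall e : R, 0 < e ->
  \forall A \near F, exists2 a, closed_set_val A a & edist2 x a < e].
have cL : closed L.
  move=> x xL e e0; have e20 : 0 < e / 2 by rewrite divr_gt0.
  have e40 : 0 < e / 2 / 2 by rewrite divr_gt0.
  have [y [Ly yx]] := xL _ (nbhsx_ballx x (e / 2 / 2) e40).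
  have := Ly _ e20; apply: filterS => A [a Aa ya]; exists a => //.
  apply: le_lt_trans (edist2_triangle y _ _) _.
  by rewrite [ltRHS]splitr ltrD// ball_edist2.
have clK : closed K by apply: compact_closed => //; exact: norm_hausdorff.
have LK : L `<=` K.
  move=> x Lx; apply: (closed_edist2 (A := ClosedSet clK)) => e e0.
  have [A [AK [a Aa xa]]] := filter_ex (filterI FK (Lx e e0)).
  by exists a => //; exact: AK.
have cLK : compact L by rewrite -(setIidr LK); exact: compact_closedI.
exists (ClosedSet cL); split=> //=.
apply/fcvg_ballP => e e0; have e20 : 0 < e / 2 by rewrite divr_gt0.
suff [LA AL] :
    (\forall A \near F, forall x, L x ->
      exists2 a, closed_set_val A a & edist2 x a <= e / 2) /\
    \forall A \near F, forall a, closed_set_val A a ->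
      exists2 x, L x & edist2 a x <= e / 2.
  apply: filterS2 LA AL => A LA AL.
  rewrite ball_closed_setE /hausdorff_dist gt_max.
  by apply/andP; split; apply: (@le_lt_trans _ _ (e / 2)%:E);
    rewrite ?lte_fin ?excess_le//; lra.
(* In both halves the offending points converge along [F]: in the first their limit is in [L], hence
   near almost all sets; in the second the limit of points of the sets is in [L] by definition. *)
split; apply: contrapT => /ultra_not nF.
  have [|x_ [x [Lx xx xF]]] := ultra_select (P := fun (A : closed_set R) x =>
      forall a, closed_set_val A a -> ~ (edist2 x a <= e / 2)) FU cLK.
    apply: filterS nF => A /existsNP[x /not_implyP[Lx nx]]; exists x => // a Aa xa.
    by apply: nx; exists a.
  have e40 : 0 < e / 2 / 2 by rewrite divr_gt0.
  have xA : \forall A \near F, edist2 x (x_ A) < e / 2 / 2 by exact: edist2_cvg.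
  have [A [[nA {}xA] [a Aa xa]]] := filter_ex (filterI (filterI xF xA) (Lx _ e40)).
  apply: (nA _ Aa); apply: le_trans (edist2_triangle x _ _) _.
  by rewrite [leRHS]splitr edist2C lerD// ltW.
have [|a_ [a [Ka aa aF]]] := ultra_select (P := fun (A : closed_set R) a =>
    closed_set_val A a /\ forall x, L x -> ~ (edist2 a x <= e / 2)) FU cK.
  apply: filterS2 FK nF => A AK /existsNP[a /not_implyP[Aa na]].
  exists a; first exact: AK.
  by split=> // x Lx ax; apply: na; exists x.
have La : L a.
  move=> r r0; have ar : \forall A \near F, edist2 a (a_ A) < r by exact: edist2_cvg.
  by apply: filterS2 aF ar => A [Aa _] ar; exists (a_ A).
have aA : \forall A \near F, edist2 a (a_ A) < e / 2 by exact: edist2_cvg.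
have [A [[_ nA] {}aA]] := filter_ex (filterI aF aA).
by apply: (nA _ La); rewrite edist2C ltW.
Qed.

End HausdorffCompactness.

(** * Barriers *)

Section Barriers.
Context {R : realType}.
Implicit Types (d : plane R -> plane R -> \bar R) (p q u v e l : plane R).

(** Otherwise offending points converge along an ultrafilter to a point [e] of [K], and
    [between_lim] makes [e] lie between [p] and [q]. The sets [C_ i] may vary, which serves for
    segments that shrink. *)
Lemma near_no_between (I : Type) (F : set_system I)
    (D : I -> plane R -> plane R -> \bar R) d (p_ q_ : I -> plane R) p q
    (C_ : I -> set (plane R)) (K : set (plane R)) : Filter F ->
  (forall U, UltraFilter U -> F `<=` U -> limsup_le U D d) ->
  liminf_ge F D p_ q_ (d p q) -> p_ @ F --> p -> q_ @ F --> q ->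
  directed_metric_neg d -> compact K -> (\forall i \near F, C_ i `<=` K) ->
  (forall U (e_ : I -> plane R) e, UltraFilter U -> F `<=` U -> K e ->
    e_ @ U --> e -> (\forall i \near U, C_ i (e_ i)) -> ~ between d p q e) ->
  \forall i \near F, forall e, C_ i e -> ~ between (D i) (p_ i) (q_ i) e.
Proof.
move=> FF Dd pq pp qq [dfin d0 _] cK CK Cd; apply: ultra_near => U UU FU.
apply: contrapT => /ultra_not nC.
have [|e_ [e [Ke ee eC]]] := @ultra_select _ _ U K
    (fun i e => C_ i e /\ between (D i) (p_ i) (q_ i) e) UU cK.
  apply: filterS2 (FU _ CK) nC => i CKi /existsNP[e /not_implyP[Ce /contrapT be]].
  by exists e; [exact: CKi|].
have nbe : ~ between d p q e.
  by apply: (Cd U e_ e) => //; apply: filterS eC => i [].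
have pe : p <> e by move=> pe; apply: nbe; rewrite -pe /between d0 add0e.
have eq : e <> q by move=> eq; apply: nbe; rewrite eq /between d0 adde0.
apply: nbe; apply: (@between_lim _ _ U D d p_ q_ e_) => //.
- exact: Dd.
- by move=> M /pq; exact: FU.
- by move=> A /pp; exact: FU.
- by move=> A /qq; exact: FU.
- by apply: filterS eC => i [].
Qed.

Lemma near_no_between_compact (I : Type) (F : set_system I)
    (D : I -> plane R -> plane R -> \bar R) d (p_ q_ : I -> plane R) p q
    (C : set (plane R)) : Filter F ->
  (forall U, UltraFilter U -> F `<=` U -> limsup_le U D d) ->
  liminf_ge F D p_ q_ (d p q) -> p_ @ F --> p -> q_ @ F --> q ->
  directed_metric_neg d -> compact C -> (forall e, C e -> ~ between d p q e) ->
  \forall i \near F, forall e, C e -> ~ between (D i) (p_ i) (q_ i) e.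
Proof.
move=> FF Dd pq pp qq hd cC Cd.
apply: (@near_no_between _ _ _ d _ _ p q (fun=> C) C) => //.
  by apply: filterE => i.
by move=> U e_ e _ _ Ce _ _; exact: Cd.
Qed.

Lemma spacetime_ninfty d p q : spacetime_metric d -> p <> q -> q.2 <= p.2 ->
  d p q = -oo%E.
Proof.
move=> [_ _ [_ _ dn] _ _] pq qp; apply: dn => //.
by rewrite /R4up/=; apply/negP; rewrite -leNgt.
Qed.

Lemma spacetime_gtNy d p q : spacetime_metric d -> p.2 < q.2 -> (-oo < d p q)%E.
Proof. by move=> [_ _ [dgt _ _] _ _]; exact: dgt. Qed.

Lemma snd_lt_neq p q : p.2 < q.2 -> p <> q.
Proof. by move=> + pq; rewrite pq ltxx. Qed.

Lemma compact_vline (m a b : R) : compact [set e : plane R | e.1 = m /\ a <= e.2 <= b].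
Proof.
have -> : [set e : plane R | e.1 = m /\ a <= e.2 <= b] = [set m] `*` `[a, b]%classic.
  by apply/seteqP; split=> -[x t] /=; rewrite in_itv.
by apply: compact_setX; [exact: compact_set1|exact: segment_compact].
Qed.

(* As del tends to 0, p and q reach the times of u and v, where d is -oo between p
   and the first vertical segment, and between the second one and q. The sign sg
   tells on which side of u and v the barrier is. *)
Lemma barrier_point d sg u v (W : set (plane R * plane R)) :
  spacetime_metric d -> sg = 1 \/ sg = - 1 -> u.2 < v.2 -> nbhs (u, v) W ->
  exists (p q : plane R) (eps del : R),
  [/\ W (p, q), 0 < eps, 0 < del,
      p = (u.1 - sg * eps, u.2 - del) /\ q = (v.1 - sg * eps, v.2 + del)
    & forall e, (e.1 = u.1 - sg * (eps / 2) /\ u.2 - 2 * del <= e.2 <= u.2 + 2 * del) \/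
                (e.1 = v.1 - sg * (eps / 2) /\ v.2 - 2 * del <= e.2 <= v.2 + 2 * del) ->
      ~ between d p q e].
Proof.
move=> hd sg1 uv /nbhs_ballP[rho /= rho0 rhoW].
have sg0 : `|sg| = 1 by case: sg1 => ->; rewrite ?normrN normr1.
pose eps := rho / 2; have eps0 : 0 < eps by rewrite divr_gt0.
pose u' : plane R := (u.1 - sg * eps, u.2); pose v' : plane R := (v.1 - sg * eps, v.2).
pose p_ del : plane R := (u.1 - sg * eps, u.2 - del).
pose q_ del : plane R := (v.1 - sg * eps, v.2 + del).
pose C_ (del : R) := [set e : plane R |
  (e.1 = u.1 - sg * (eps / 2) /\ u.2 - 2 * del <= e.2 <= u.2 + 2 * del) \/
  (e.1 = v.1 - sg * (eps / 2) /\ v.2 - 2 * del <= e.2 <= v.2 + 2 * del)].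
(* A compact set independent of [del] that contains the segments [C_ del] as soon as [del <= 1]. *)
pose K := [set e : plane R | e.1 = u.1 - sg * (eps / 2) /\ u.2 - 2 <= e.2 <= u.2 + 2]
  `|` [set e : plane R | e.1 = v.1 - sg * (eps / 2) /\ v.2 - 2 <= e.2 <= v.2 + 2].
have id0 : (del : R) @[del --> 0^'+] --> (0 : R).
  by apply: cvg_at_right_filter; exact: cvg_id.
have pp : p_ @ 0^'+ --> u'.
  apply: cvg_pairP; first exact: cvg_cst.
  rewrite -[X in _ --> X]subr0; apply: cvgB; first exact: cvg_cst.
  exact: id0.
have qq : q_ @ 0^'+ --> v'.
  apply: cvg_pairP; first exact: cvg_cst.
  rewrite -[X in _ --> X]addr0; apply: cvgD; first exact: cvg_cst.
  exact: id0.
have [dm _ _ _ _] := hd.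
have cK : compact K by apply: compactU; exact: compact_vline.
have nC : \forall del \near 0^'+, forall e, C_ del e -> ~ between d (p_ del) (q_ del) e.
  apply: (@near_no_between _ _ (fun=> d) d p_ q_ u' v' C_ K) => //.
  - by move=> U UU _; exact: spacetime_limsup.
  - by apply: spacetime_liminf => //; exact: snd_lt_neq.
  - near=> del; have del1 : del <= 1 by near: del; exact: nbhs_right_le.
    by move=> e [] [e1 /andP[e2 e3]]; [left|right]; split=> //; apply/andP; split; lra.
  - move=> U e_ e UU FU Ke ee eC be.
    have [ue ev] := between_dgt (spacetime_gtNy hd (uv : u'.2 < v'.2)) be.
    have FtU : Filter U by exact: filter_filter.
    have e1 := cvg_fst_comp FtU ee; have e2 := cvg_snd_comp FtU ee.
    have del0 : (id : R -> R) @ U --> (0 : R).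
      by move=> A A0; apply: FU; exact: id0.
    (* The segment around [w] shrinks to one point as [del] tends to 0. This point has the time of
       [w] but, by [neq], is displaced from [u'] or [v']. *)
    have lim (w : plane R) : (\forall del \near U,
        (e_ del).1 = w.1 - sg * (eps / 2) /\
        w.2 - 2 * del <= (e_ del).2 <= w.2 + 2 * del) ->
        e.1 = w.1 - sg * (eps / 2) /\ e.2 = w.2.
      move=> Uw; split.
        have c1 : (e_ del).1 @[del --> U] --> w.1 - sg * (eps / 2).
          apply: cvg_near_cst; apply: filterS Uw => del [+ _]; exact.
        exact: (cvg_unique (@Rhausdorff R) e1 c1).
      have c2 : (e_ del).2 @[del --> U] --> w.2.
        apply: (@squeeze_cvgr _ _ _ _ (fun del => w.2 - 2 * del) (fun del => w.2 + 2 * del)).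
        - by apply: filterS Uw => del [_].
        - rewrite -[X in _ --> X]subr0 -(mulr0 2); apply: cvgB; first exact: cvg_cst.
          by apply: cvgM; [exact: cvg_cst|].
        - rewrite -[X in _ --> X]addr0 -(mulr0 2); apply: cvgD; first exact: cvg_cst.
          by apply: cvgM; [exact: cvg_cst|].
      exact: (cvg_unique (@Rhausdorff R) e2 c2).
    have neq (w : plane R) : e.1 = w.1 - sg * (eps / 2) -> e.1 <> w.1 - sg * eps.
      by move=> -> h; case: sg1 => sgE; rewrite sgE in h; lra.
    have [Uu|/ultra_not nUu] := pselect (\forall del \near U,
        (e_ del).1 = u.1 - sg * (eps / 2) /\
        u.2 - 2 * del <= (e_ del).2 <= u.2 + 2 * del).
      have [/neq eu1 eu2] := lim _ Uu.
      have ne : u' <> e by move=> ueE; apply: eu1; rewrite -ueE.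
      by move: ue; rewrite (spacetime_ninfty hd ne) ?eu2.
    have Uv : \forall del \near U, (e_ del).1 = v.1 - sg * (eps / 2) /\
        v.2 - 2 * del <= (e_ del).2 <= v.2 + 2 * del.
      by apply: filterS2 eC nUu => del [].
    have [/neq ev1 ev2] := lim _ Uv.
    have ne : e <> v' by move=> evE; apply: ev1; rewrite evE.
    by move: ev; rewrite (spacetime_ninfty hd ne) ?ev2.
have [del [[del0 delrho] Cdel]] : exists del : R, (0 < del /\ del < rho) /\
    forall e, C_ del e -> ~ between d (p_ del) (q_ del) e.
  apply: (@filter_ex _ 0^'+); near=> del; split; last by near: del.
  by split; near: del; [exact: nbhs_right_gt|exact: nbhs_right_lt].
exists (p_ del), (q_ del), eps, del; split=> //.
have sge : `|sg * eps| < rho.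
  by rewrite normrM sg0 mul1r gtr0_norm// /eps ltr_pdivrMr// ltr_pMr// ltr1n.
have dele : `|del| < rho by rewrite gtr0_norm.
have b1 : `|u.1 - (u.1 - sg * eps)| < rho by rewrite opprB addrCA subrr addr0.
have b2 : `|u.2 - (u.2 - del)| < rho by rewrite opprB addrCA subrr addr0.
have b3 : `|v.1 - (v.1 - sg * eps)| < rho by rewrite opprB addrCA subrr addr0.
have b4 : `|v.2 - (v.2 + del)| < rho by rewrite opprD addrA subrr sub0r normrN.
by apply: rhoW; exact: (conj (conj b1 b2) (conj b3 b4)).
Unshelve. all: by end_near. Qed.

End Barriers.

(** * Barriers for a single metric *)

Section Sides.
Context {R : realType}.
Implicit Types (sg a b c eps del m : R) (p q u v e l P Q U V : plane R)
  (D : plane R -> plane R -> \bar R) (G : set (plane R)).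

Lemma side_between sg a b c : sg = 1 \/ sg = - 1 ->
  sg * a <= sg * b -> sg * b <= sg * c -> Num.min a c <= b <= Num.max a c.
Proof.
by case=> ->; rewrite ?mul1r ?mulN1r ?mulNr ?mul1r ?lerN2 => ab bc;
  rewrite ge_min le_max ab bc ?orbT.
Qed.

Lemma side_dist sg a b eps : sg = 1 \/ sg = - 1 -> `|a - b| < eps ->
  sg * a < sg * b + eps /\ sg * b < sg * a + eps.
Proof. by rewrite ltr_norml => -[] -> /andP[? ?]; split; lra. Qed.

Lemma side_shift sg a b : sg = 1 \/ sg = - 1 -> sg * (a - sg * b) = sg * a - b.
Proof. by case=> ->; lra. Qed.

Lemma min_max_bound a b c (lo hi : R) : lo <= a <= hi -> lo <= c <= hi ->
  Num.min a c <= b <= Num.max a c -> lo <= b <= hi.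
Proof.
move=> /andP[a1 a2] /andP[c1 c2] /andP[b1 b2]; apply/andP; split.
  by apply: le_trans b1; rewrite le_min a1.
by apply: le_trans b2 _; rewrite ge_max a2.
Qed.

(** To pass [U] or [V] on the wrong side, a geodesic from [P] to [Q] would cross one of the vertical
    segments that [nb] keeps free. Hence [geodesic_barrier] applies. *)
Lemma barrier_level D sg p q u v P Q U V eps del m G : causal D ->
  monotone_curves D -> sg = 1 \/ sg = - 1 -> 0 < eps -> 0 < del ->
  m <= eps / 4 -> m <= del / 4 ->
  p = (u.1 - sg * eps, u.2 - del) -> q = (v.1 - sg * eps, v.2 + del) ->
  ball p m P -> ball q m Q -> ball u m U -> ball v m V ->
  (-oo < D P Q)%E -> geodesic D U V G ->
  (forall e,
    (e.1 = u.1 - sg * (eps / 2) /\ u.2 - 2 * del <= e.2 <= u.2 + 2 * del) \/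
    (e.1 = v.1 - sg * (eps / 2) /\ v.2 - 2 * del <= e.2 <= v.2 + 2 * del) ->
    ~ between D P Q e) ->
  forall e, G e -> exists2 l, between D P Q l & l.2 = e.2 /\ sg * l.1 <= sg * e.1.
Proof.
move=> cD cvD sg1 eps0 del0 me md pE qE.
move=> [/(side_dist sg1)[p1 p2] +] [/(side_dist sg1)[q1 q2] +].
move=> + + [/(side_dist sg1)[u1 u2] +] [/(side_dist sg1)[v1 v2] +].
rewrite /ball/= !ltr_norml => /andP[p3 p4] /andP[q3 q4] /andP[u3 u4] /andP[v3 v4].
move=> PQ gG nb.
have [p1E p2E] : sg * p.1 = sg * u.1 - eps /\ p.2 = u.2 - del.
  by rewrite pE/= side_shift.
have [q1E q2E] : sg * q.1 = sg * v.1 - eps /\ q.2 = v.2 + del.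
  by rewrite qE/= side_shift.
have [[_ d0 _] _] := cD.
have [L gL _] : exists2 L, geodesic D P Q L & L P.
  by apply: geodesic_through => //; rewrite /between d0 add0e.
have [_ Lp Lq _ _] := geodesicP cD gL.
have sg0 : sg != 0 by case: sg1 => ->; rewrite ?oppr_eq0 oner_eq0.
apply: (geodesic_barrier cD cvD sg0 gL gG) => //.
- by clear -p3 p2E u4 md del0; lra.
- by clear -q4 q2E v3 md del0; lra.
(* The segment is halfway between the spatial coordinates of [p] and [u], and [P], [U] are within a
   quarter of [eps] of these, so it separates [P] from [l]. The crossing occurs between the times of
   [P] and [U], within [2 * del] of [u.2]. *)
- move=> l Ll lu; rewrite leNgt; apply/negP => ul.
  have [|e' Le' [e'1]] := @geodesic_ivt_space _ _ _ _ _ P l (u.1 - sg * (eps / 2))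
      cD cvD gL Lp Ll.
    apply: (side_between sg1); rewrite side_shift//.
      by clear -p2 p1E me eps0; lra.
    by clear -ul u1 me eps0; lra.
  rewrite lu => /(@min_max_bound _ _ _ (u.2 - 2 * del) (u.2 + 2 * del)) e'2.
  apply: (nb e'); last exact: geodesic_sub_between Le'.
  left; split=> //; apply: e'2; apply/andP; first by clear -p3 p4 p2E md del0; split; lra.
  by clear -u3 u4 md del0; split; lra.
- move=> l Ll lv; rewrite leNgt; apply/negP => vl.
  have [|e' Le' [e'1]] := @geodesic_ivt_space _ _ _ _ _ Q l (v.1 - sg * (eps / 2))
      cD cvD gL Lq Ll.
    apply: (side_between sg1); rewrite side_shift//.
      by clear -q2 q1E me eps0; lra.
    by clear -vl v1 me eps0; lra.
  rewrite lv => /(@min_max_bound _ _ _ (v.2 - 2 * del) (v.2 + 2 * del)) e'2.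
  apply: (nb e'); last exact: geodesic_sub_between Le'.
  right; split=> //; apply: e'2; apply/andP; first by clear -q3 q4 q2E md del0; split; lra.
  by clear -v3 v4 md del0; split; lra.
Qed.

End Sides.

(** * Barriers along the sequence and bounds on the geodesics *)

Section Convergence.
Context {R : realType} (dn : nat -> plane R -> plane R -> \bar R)
  (d : plane R -> plane R -> \bar R).
Hypotheses (dnc : forall n, causal (dn n)) (dncurve : forall n, monotone_curves (dn n))
  (hd : spacetime_metric d) (hcvg : hypo_cvg dn d).
Context (un vn : nat -> plane R) (u v : plane R) (Gn : nat -> set (plane R)).
Hypotheses (uv : u.2 < v.2) (unu : un @ \oo --> u) (vnv : vn @ \oo --> v)
  (Gng : \forall n \near \oo, geodesic (dn n) (un n) (vn n) (Gn n)).

Let dm : directed_metric_neg d. Proof. by case: hd. Qed.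

Let dn_limsup U : UltraFilter U -> \oo `<=` U -> limsup_le U dn d.
Proof. by move=> UU oU; exact: hypo_cvg_limsup. Qed.

Let near_no_between_dn (p_ q_ : nat -> plane R) (p q : plane R) (C : set (plane R)) :
  liminf_ge \oo dn p_ q_ (d p q) -> p_ @ \oo --> p -> q_ @ \oo --> q ->
  compact C -> (forall e : plane R, C e -> ~ between d p q e) ->
  \forall n \near \oo, forall e : plane R, C e -> ~ between (dn n) (p_ n) (q_ n) e.
Proof.
by move=> pq pp qq cC Cd; exact: (near_no_between_compact _ dn_limsup pq pp qq dm cC Cd).
Qed.

(** The free vertical segments of [barrier_point] stay free for [dn] along good pairs, because they
    are compact. *)
Lemma barrier sg (W : set (plane R * plane R)) : sg = 1 \/ sg = - 1 ->
  nbhs (u, v) W -> exists (p q : plane R) (p_ q_ : nat -> plane R),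
  [/\ [/\ W (p, q), p.2 < u.2 & v.2 < q.2],
      p_ @ \oo --> p, q_ @ \oo --> q, liminf_ge \oo dn p_ q_ (d p q)
    & \forall n \near \oo, (-oo < dn n (p_ n) (q_ n))%E /\ forall e, Gn n e ->
        exists2 l, between (dn n) (p_ n) (q_ n) l & l.2 = e.2 /\ sg * l.1 <= sg * e.1].
Proof.
move=> sg1 /(barrier_point hd sg1 uv)[p [q [eps [del [Wpq eps0 del0 [pE qE] nb]]]]].
have pu : p.2 < u.2 by rewrite pE/=; lra.
have vq : v.2 < q.2 by rewrite qE/=; lra.
have pq : p.2 < q.2 by rewrite (lt_trans pu)// (lt_trans uv).
have [p_ [q_ [pp qq pqinf]]] := hypo_cvg_liminf hd hcvg pq.
exists p, q, p_, q_; split=> //.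
pose Ku := [set e : plane R | e.1 = u.1 - sg * (eps / 2) /\
  u.2 - 2 * del <= e.2 <= u.2 + 2 * del].
pose Kv := [set e : plane R | e.1 = v.1 - sg * (eps / 2) /\
  v.2 - 2 * del <= e.2 <= v.2 + 2 * del].
have nKu : \forall n \near \oo, forall e : plane R, Ku e -> ~ between (dn n) (p_ n) (q_ n) e.
  apply: (@near_no_between_dn _ _ _ _ Ku pqinf pp qq); first exact: compact_vline.
  by move=> e Ke; apply: nb; left.
have nKv : \forall n \near \oo, forall e : plane R, Kv e -> ~ between (dn n) (p_ n) (q_ n) e.
  apply: (@near_no_between_dn _ _ _ _ Kv pqinf pp qq); first exact: compact_vline.
  by move=> e Ke; apply: nb; right.
(* Any real number below [d p q] forces [dn] along the good pairs to be above -oo eventually. *)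
have [M _ /pqinf pqM] : exists2 M : R, True & (M%:E < d p q)%E.
  by have [M [_ Mpq]] := lte_dense_fin (spacetime_gtNy hd pq); exists M.
have eps4 : 0 < eps / 4 by rewrite divr_gt0.
have del4 : 0 < del / 4 by rewrite divr_gt0.
pose m := Num.min (eps / 4) (del / 4); have m0 : 0 < m by rewrite lt_min eps4.
have [me md] : m <= eps / 4 /\ m <= del / 4 by split; rewrite ge_min lexx ?orbT.
clearbody m.
near=> n.
have pqMn : (M%:E < dn n (p_ n) (q_ n))%E by near: n; exact: pqM.
have pqn : (-oo < dn n (p_ n) (q_ n))%E by apply: lt_trans pqMn; rewrite ltNyr.
split=> // e Ge.
have Gg : geodesic (dn n) (un n) (vn n) (Gn n) by near: n.
move: e Ge; apply: (barrier_level (dnc n) (@dncurve n) sg1 eps0 del0 me md pE qE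
  _ _ _ _ pqn Gg).
- by near: n; exact: (cvg_ball pp).
- by near: n; exact: (cvg_ball qq).
- by near: n; exact: (cvg_ball unu).
- by near: n; exact: (cvg_ball vnv).
- by move=> e [Kue|Kve]; [move: (e) Kue|move: (e) Kve]; near: n.
Unshelve. all: by end_near. Qed.

Lemma spacetime_confined : exists M : R,
  forall e : plane R, between d u v e -> `|e.1| < M.
Proof.
have [_ _ _ _ d3] := hd.
have [a [b ab]] : exists a b : R, forall G, geodesic d u v G ->
    G `<=` `[a, b]%classic `*` `[u.2, v.2]%classic.
  case: (u) (v) uv => [x s] [y t] st; exact: d3.
exists (`|a| + `|b| + 1) => e.
move=> /(geodesic_through (spacetime_causal hd) (spacetime_gtNy hd uv))[G gG Ge].
have [/= + _] := ab _ gG _ Ge; rewrite in_itv/= => /andP[ae eb].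
have := ler_norm b; have := ler_norm (- a); rewrite normrN ltr_norml.
have := normr_ge0 a; have := normr_ge0 b => *; apply/andP; split; lra.
Qed.

Lemma between_left : between d u v u.
Proof. by have [_ d0 _] := dm; rewrite /between d0 add0e. Qed.

(** The lower bound [- M] comes from a vertical segment [C1] free of points between [u] and [v]: it
    stays free for nearby endpoints and for [dn], and a geodesic from [p_ n] to a point beyond it
    would have to cross it. The set [C] is a further obstacle, also kept free for [(p, q)]. *)
Lemma sided_barrier sg (M : R) (C : set (plane R)) : sg = 1 \/ sg = - 1 ->
  (forall e, between d u v e -> `|e.1| < M) -> compact C ->
  (forall e, C e -> ~ between d u v e) ->
  exists (p q : plane R) (p_ q_ : nat -> plane R),
  [/\ [/\ forall e, C e -> ~ between d p q e, p.2 < u.2 & v.2 < q.2],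
      p_ @ \oo --> p, q_ @ \oo --> q, liminf_ge \oo dn p_ q_ (d p q)
    & \forall n \near \oo, forall e, Gn n e ->
        exists2 l, between (dn n) (p_ n) (q_ n) l &
          l.2 = e.2 /\ - M <= sg * l.1 <= sg * e.1].
Proof.
move=> sg1 uvM cC Cuv.
pose C1 := [set e : plane R | e.1 = - (sg * M) /\ u.2 - 1 <= e.2 <= v.2 + 1].
have sgsg a : sg * (sg * a) = a by case: sg1 => ->; lra.
have C1uv e : C1 e -> ~ between d u v e.
  move=> [e1 _] /uvM; rewrite e1 normrN normrM.
  have -> : `|sg| = 1 by case: sg1 => ->; rewrite ?normrN normr1.
  by rewrite mul1r ltNge ler_norm.
have cC1 : compact C1 by exact: compact_vline.
have Mu := uvM _ between_left.
(* This radius keeps [p] on the inner side of the line of [C1], and the times of [p] and [q] within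
   those of [C1]. *)
pose eta := Num.min 1 (M - `|u.1|); have eta0 : 0 < eta by rewrite lt_min ltr01 subr_gt0.
have [eta1 etaM] : eta <= 1 /\ eta <= M - `|u.1| by split; rewrite ge_min lexx ?orbT.
have fst_cvg : (fun r : plane R * plane R => r.1) @ nbhs (u, v) --> u.
  exact: (cvg_fst_comp (f := id) _ cvg_id).
have snd_cvg : (fun r : plane R * plane R => r.2) @ nbhs (u, v) --> v.
  exact: (cvg_snd_comp (f := id) _ cvg_id).
have Wuv : nbhs (u, v) [set r : plane R * plane R |
    (forall e, (C `|` C1) e -> ~ between d r.1 r.2 e) /\ ball (u, v) eta r].
  apply: filterI; last exact: nbhsx_ballx.
  apply: (near_no_between_compact (D := fun=> d) _ _ _ fst_cvg snd_cvg dm).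
  - by move=> U UU _; exact: spacetime_limsup.
  - by apply: spacetime_liminf => //; exact: snd_lt_neq.
  - exact: compactU.
  - by move=> e [/Cuv|/C1uv].
have [p [q [p_ [q_ [[[CW pqball] pu vq] pp qq pqinf bar]]]]] := barrier sg1 Wuv.
exists p, q, p_, q_; split=> //; first by split=> // e Ce; apply: CW; left.
have nC1 : \forall n \near \oo, forall e : plane R, C1 e ->
    ~ between (dn n) (p_ n) (q_ n) e.
  by apply: (@near_no_between_dn _ _ _ _ C1 pqinf pp qq) => // e Ce; apply: CW; right.
have [[b1 b2] [_ b4]] := pqball.
have p1 : - M < sg * p.1.
  have [h _] := side_dist sg1 b1; apply: le_lt_trans (_ : sg * u.1 - eta < _); last by lra.
  have : `|sg * u.1| = `|u.1| by case: sg1 => ->; rewrite ?mulN1r ?mul1r ?normrN.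
  by have := ler_norm (- (sg * u.1)); rewrite normrN => *; lra.
have p2 : u.2 - 1 < p.2 by move: b2; rewrite /ball/= ltr_norml => /andP[*]; lra.
have q2 : q.2 < v.2 + 1 by move: b4; rewrite /ball/= ltr_norml => /andP[*]; lra.
have sp_cvg : sg * (p_ n).1 @[n --> \oo] --> sg * p.1.
  by apply: cvgM; [exact: cvg_cst|exact: cvg_fst_comp].
near=> n => e Ge.
have [pqn /(_ e Ge)[l ll [le lsg]]] : (-oo < dn n (p_ n) (q_ n))%E /\ forall e, Gn n e ->
    exists2 l, between (dn n) (p_ n) (q_ n) l & l.2 = e.2 /\ sg * l.1 <= sg * e.1.
  by near: n.
exists l => //; split=> //; rewrite lsg andbT leNgt; apply/negP => lM.
have [L gL Ll] := geodesic_through (dnc n) pqn ll.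
have [_ Lp _ Lpq _] := geodesicP (dnc n) gL.
have [|e' Le' [e'1 _]] := @geodesic_ivt_space _ _ _ _ _ l (p_ n) (- (sg * M))
    (dnc n) (@dncurve n) gL Ll Lp.
  apply: (side_between sg1); rewrite mulrN sgsg; first exact: ltW.
  by apply: ltW; near: n; exact: (cvgr_gt _ sp_cvg).
have [/time_le_snd pe' /time_le_snd e'q] := Lpq _ Le'.
have nC1n : forall e : plane R, C1 e -> ~ between (dn n) (p_ n) (q_ n) e by near: n.
apply: (nC1n e'); last exact: geodesic_sub_between Le'.
split=> //; apply/andP; split.
  apply: le_trans pe'; apply: ltW; near: n.
  by apply: (cvgr_gt _ (cvg_snd_comp _ pp)).
apply: (le_trans e'q); apply: ltW; near: n.
by apply: (cvgr_lt _ (cvg_snd_comp _ qq)).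
Unshelve. all: by end_near. Qed.

Lemma geodesics_bounded : exists a b : plane R, \forall n \near \oo,
  Gn n `<=` `[a.1, b.1]%classic `*` `[a.2, b.2]%classic.
Proof.
have [M uvM] := spacetime_confined.
have side sg : sg = 1 \/ sg = - 1 -> \forall n \near \oo, forall e, Gn n e -> - M <= sg * e.1.
  move=> sg1; have [|p [q [p_ [q_ [_ _ _ _]]]]] := sided_barrier sg1 uvM (@compact0 _) => //.
  by apply: filterS => n bar e /bar[l _ [_ /andP[Ml le]]]; exact: le_trans le.
exists (- M, u.2 - 1), (M, v.2 + 1) => /=.
have u2 : (un n).2 @[n --> \oo] --> u.2 by exact: cvg_snd_comp.
have v2 : (vn n).2 @[n --> \oo] --> v.2 by exact: cvg_snd_comp.
near=> n => e Ge.
have Gg : geodesic (dn n) (un n) (vn n) (Gn n) by near: n.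
have [_ _ _ Guv _] := geodesicP (dnc n) Gg.
have [/time_le_snd ue /time_le_snd ev] := Guv _ Ge.
have h1 : - M <= 1 * e.1 by move: (e) Ge; near: n; apply: side; left.
have h2 : - M <= -1 * e.1 by move: (e) Ge; near: n; apply: side; right.
have h3 : u.2 - 1 < (un n).2 by near: n; apply: (cvgr_gt _ u2); rewrite ltrBlDr ltrDl.
have h4 : (vn n).2 < v.2 + 1 by near: n; apply: (cvgr_lt _ v2); rewrite ltrDl.
by split; rewrite /= in_itv/=; apply/andP; split; lra.
Unshelve. all: by end_near. Qed.

(** If all points between [u] and [v] at the time of [e] were strictly beyond [e], the horizontal
    segment [C] from the bound [M] to [e] would be free of them. But the barrier points next to
    [e_ n] accumulate at a point of [C] that is between [p] and [q]. *)
Lemma limit_side sg (U : set_system nat) (e_ : nat -> plane R) e :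
  sg = 1 \/ sg = - 1 -> UltraFilter U -> \oo `<=` U ->
  (\forall n \near U, Gn n (e_ n)) -> e_ @ U --> e -> u.2 <= e.2 <= v.2 ->
  ~ (forall c, between d u v c -> c.2 = e.2 -> sg * e.1 < sg * c.1).
Proof.
move=> sg1 UU oU Ge ee /andP[ue ev] eside.
have sgsg a : sg * (sg * a) = a by case: sg1 => ->; lra.
have FtU : Filter U by exact: filter_filter.
have [M uvM] := spacetime_confined.
pose C : set (plane R) := [set (sg * x, e.2) | x in `[- M, sg * e.1]%classic].
have cC : compact C.
  apply: continuous_compact; last exact: segment_compact.
  apply: continuous_subspaceT => x; apply: cvg_pairP; last exact: cvg_cst.
  by apply: cvgM; [exact: cvg_cst|exact: cvg_id].
have Cuv c : C c -> ~ between d u v c.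
  move=> [x /=]; rewrite in_itv/= => /andP[_ xe] <- /eside/=.
  by move=> /(_ erefl); rewrite sgsg ltNge xe.
have [p [q [p_ [q_ [[Cpq pu vq] pp qq pqinf bar]]]]] := sided_barrier sg1 uvM cC Cuv.
(* Bounds the barrier points once [e_ n] is within 1 of [e]: they are at least [- M] and at most
   [sg * (e_ n).1], up to the sign [sg]. *)
pose B := M + `|e.1| + 1.
have cK : compact (`[- B, B]%classic `*` `[e.2 - 1, e.2 + 1]%classic).
  by apply: compact_setX; exact: segment_compact.
have [|l_ [l [_ ll lU]]] := ultra_select (P := fun n l =>
    between (dn n) (p_ n) (q_ n) l /\ l.2 = (e_ n).2 /\ - M <= sg * l.1 <= sg * (e_ n).1)
    UU cK.
  have e1 : \forall n \near U, ball e 1 (e_ n) by exact: (cvg_ball ee).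
  apply: filterS3 (oU _ bar) Ge e1 => n barn /barn[l pql [le /andP[Ml lse]]] [b1 b2].
  exists l; last by rewrite Ml lse.
  have [_ h1] := side_dist sg1 b1.
  have h2 : sg * e.1 <= `|e.1|.
    by apply: (le_trans (ler_norm _)); case: sg1 => ->; rewrite ?mulN1r ?mul1r ?normrN.
  move: b2; rewrite /ball/= ltr_norml => /andP[b3 b4].
  have [h3 h4] : - B <= sg * l.1 /\ sg * l.1 <= B.
    have M0 := le_lt_trans (normr_ge0 _) (uvM _ between_left).
    by have := normr_ge0 e.1; rewrite /B; split; lra.
  clearbody B; split; rewrite /= in_itv/=; last by rewrite le; apply/andP; split; lra.
  by case: sg1 h3 h4 => -> h3 h4; apply/andP; split; lra.
have lpq : \forall n \near U, between (dn n) (p_ n) (q_ n) (l_ n).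
  by apply: filterS lU => n [].
have l2 : l.2 = e.2.
  apply: (cvg_unique (@Rhausdorff R) (cvg_snd_comp FtU ll)).
  have e2 := cvg_snd_comp FtU ee; apply: cvg_trans e2; apply: near_eq_cvg.
  by apply: filterS lU => n [_ [->]].
have sl : sg * (l_ n).1 @[n --> U] --> sg * l.1.
  by apply: cvgM; [exact: cvg_cst|exact: cvg_fst_comp].
have se : sg * (e_ n).1 @[n --> U] --> sg * e.1.
  by apply: cvgM; [exact: cvg_cst|exact: cvg_fst_comp].
apply: (Cpq l).
  exists (sg * l.1); last by rewrite sgsg -l2; case: (l).
  rewrite /= in_itv/=; apply/andP; split.
    by apply: (ler_cvg_to (cvg_cst (- M)) sl); apply: filterS lU => n [_ [_ /andP[]]].
  by apply: (ler_cvg_to sl se); apply: filterS lU => n [_ [_ /andP[]]].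
apply: (@between_lim _ _ U dn d p_ q_ l_) => //.
- by case: dm.
- exact: dn_limsup.
- by move=> N /pqinf; exact: oU.
- by move=> A /pp; exact: oU.
- by move=> A /qq; exact: oU.
- by apply: snd_lt_neq; rewrite l2 (lt_le_trans pu).
- by apply: snd_lt_neq; rewrite l2 (le_lt_trans ev).
Qed.

End Convergence.

(** * The case of a unique geodesic *)

Section UniqueGeodesic.
Context {R : realType} (d : plane R -> plane R -> \bar R) (u v : plane R).
Hypotheses (hd : spacetime_metric d) (uv : u.2 < v.2).

Let dc : causal d. Proof. exact: spacetime_causal. Qed.

Let uv_gt : (-oo < d u v)%E. Proof. exact: spacetime_gtNy. Qed.

Lemma between_slice (r : R) : u.2 <= r <= v.2 -> exists2 c, between d u v c & c.2 = r.
Proof.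
have [[_ d0 _] _] := dc.
move=> /andP[]; rewrite le_eqVlt => /orP[/eqP <- _|ur].
  by exists u => //; rewrite /between d0 add0e.
rewrite le_eqVlt => /orP[/eqP ->|rv].
  by exists v => //; rewrite /between d0 adde0.
have [_ _ _ d2 _] := hd.
have [[z zE] _] := d2 u.2 r v.2 u.1 v.1 ur rv.
by exists (z, r) => //; rewrite /between; move: zE; rewrite -!surjective_pairing => ->.
Qed.

Lemma between_closed : closed [set e | between d u v e].
Proof.
move=> e ecl; have [_ d0 _] := dc.1.
apply: contrapT => nbe.
have ue : u <> e by move=> ue; apply: nbe; rewrite -ue /between/= d0 add0e.
have ev : e <> v by move=> ev; apply: nbe; rewrite ev /between/= d0 adde0.
have [|x [bx]] := ecl [set x | ~ between d u v x]; last exact.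
apply: (@ultra_near _ (nbhs e)) => U UU eU; apply: contrapT => /ultra_not bU; apply: nbe.
have FtU : Filter U by exact: filter_filter.
apply: (@between_lim _ _ U (fun=> d) d (fun=> u) (fun=> v) id) => //.
- by case: dc.1.
- exact: spacetime_limsup.
- by apply: spacetime_liminf => //; [exact: cvg_cst|exact: cvg_cst|exact: snd_lt_neq].
- exact: cvg_cst.
- exact: cvg_cst.
- by apply: filterS bU => x; exact: contrapT.
Qed.

Context (G : set (plane R)).
Hypotheses (Gg : geodesic d u v G) (Guniq : forall G', geodesic d u v G' -> G' = G).

(** Every point between [u] and [v] lies on some geodesic, and there is only one. *)
Let GE : G = [set e | between d u v e].
Proof.
apply/seteqP; split=> e /=; first exact: geodesic_sub_between.
by move=> /(geodesic_through dc uv_gt)[G' /Guniq <-].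
Qed.

Lemma unique_geodesic_closed : closed G.
Proof. by rewrite GE; exact: between_closed. Qed.

(** Two distinct points of [G] at one time would make the value -oo a summand of [d u b]. *)
Lemma unique_geodesic_time a b : G a -> G b -> a.2 = b.2 -> a = b.
Proof.
have [_ Gu _ Guv Gd] := geodesicP dc Gg.
suff wlog_le a' b' : G a' -> G b' -> a'.2 = b'.2 -> time_le a' b' -> a' = b'.
  move=> Ga Gb ab; have [/wlog_le|/wlog_le ba] := time_le_total a b; first exact.
  by apply/esym; exact: ba.
move=> Ga Gb ab le_ab; apply: contrapT => nab.
have [ub _] := between_dgt uv_gt (geodesic_sub_between dc Gg Gb).
move: ub; rewrite (Gd u a' b')//; last by have [] := Guv _ Ga.
by move=> /adde_gtNy[_]; rewrite (spacetime_ninfty hd nab) ?ltxx// ab.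
Qed.

Lemma unique_geodesic_compact : compact G.
Proof.
have [_ _ _ _ d3] := hd.
have [a [b ab]] : exists a b : R, forall G, geodesic d u v G ->
    G `<=` `[a, b]%classic `*` `[u.2, v.2]%classic.
  case: (u) (v) uv => [x s] [y t] st; exact: d3.
apply: (subclosed_compact unique_geodesic_closed _ (ab _ Gg)).
by apply: compact_setX; exact: segment_compact.
Qed.

Context (dn : nat -> plane R -> plane R -> \bar R).
Hypotheses (dnc : forall n, causal (dn n)) (dncurve : forall n, monotone_curves (dn n))
  (hcvg : hypo_cvg dn d).
Context (un vn : nat -> plane R) (Gn : nat -> set (plane R)).
Hypotheses (unu : un @ \oo --> u) (vnv : vn @ \oo --> v)
  (Gng : \forall n \near \oo, geodesic (dn n) (un n) (vn n) (Gn n)).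

(** At the time of [e] there is exactly one point [c] between [u] and [v]; [limit_side] with both
    signs leaves only [e = c]. *)
Lemma limit_in_geodesic (U : set_system nat) (e_ : nat -> plane R) e :
  UltraFilter U -> \oo `<=` U ->
  (\forall n \near U, Gn n (e_ n)) -> e_ @ U --> e -> G e.
Proof.
move=> UU oU Ge ee; have FtU : Filter U by exact: filter_filter.
have e2 := cvg_snd_comp FtU ee.
have u2 : (un n).2 @[n --> U] --> u.2.
  by apply: cvg_snd_comp => A /unu; exact: oU.
have v2 : (vn n).2 @[n --> U] --> v.2.
  by apply: cvg_snd_comp => A /vnv; exact: oU.
have eT : \forall n \near U, (un n).2 <= (e_ n).2 <= (vn n).2.
  apply: filterS2 (oU _ Gng) Ge => n gG Gen.
  have [_ _ _ Guv _] := geodesicP (dnc n) gG.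
  by have [/time_le_snd -> /time_le_snd ->] := Guv _ Gen.
have uev : u.2 <= e.2 <= v.2.
  apply/andP; split.
    by apply: (ler_cvg_to u2 e2); apply: filterS eT => n /andP[].
  by apply: (ler_cvg_to e2 v2); apply: filterS eT => n /andP[].
have [c bc ce] := between_slice uev.
have Gc : G c by rewrite GE.
have side (sg : R) : sg = 1 \/ sg = - 1 -> ~ sg * e.1 < sg * c.1.
  move=> sg1 ec; have := limit_side dnc dncurve hd hcvg uv unu vnv Gng sg1 UU oU Ge ee uev.
  apply=> c' bc' c'e.
  by rewrite (@unique_geodesic_time c' c)// ?c'e// GE.
have -> : e = c; last by [].
rewrite [LHS]surjective_pairing [RHS]surjective_pairing ce; congr pair.
apply/eqP; rewrite eq_le !leNgt; apply/andP; split; apply/negP => lt.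
  by apply: (side (- 1)); [right|rewrite !mulN1r ltrN2].
by apply: (side 1); [left|rewrite !mul1r].
Qed.

Lemma geodesics_near_limit (e : R) : 0 < e ->
  \forall n \near \oo, forall a, Gn n a -> exists2 g, G g & edist2 a g <= e.
Proof.
move=> e0; have [lo [hi bnd]] := geodesics_bounded dnc dncurve hd hcvg uv unu vnv Gng.
apply: ultra_near => U UU oU; apply: contrapT => /ultra_not nU.
have FtU : Filter U by exact: filter_filter.
have cK : compact (`[lo.1, hi.1]%classic `*` `[lo.2, hi.2]%classic).
  by apply: compact_setX; exact: segment_compact.
have [|a_ [a [_ aa aU]]] := ultra_select (P := fun n a =>
    Gn n a /\ forall g, G g -> ~ (edist2 a g <= e)) UU cK.
  apply: filterS2 (oU _ bnd) nU => n nK /existsNP[a /not_implyP[Ga na]].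
  exists a; first exact: nK.
  by split=> // g Gg' ag; apply: na; exists g.
have Ga : G a.
  by apply: (limit_in_geodesic UU oU _ aa); apply: filterS aU => n [].
have aE : \forall n \near U, edist2 a (a_ n) < e by exact: edist2_cvg.
have [n [[_ nG] {}aE]] := filter_ex (filterI aU aE).
by apply: (nG _ Ga); rewrite edist2C ltW.
Qed.

(** For [g] a limit of points of [G] far from the [Gn n], points of [Gn n] at nearly the time of [g]
    converge to a point of [G] at exactly that time, which is [g]. *)
Lemma limit_near_geodesics (e : R) : 0 < e ->
  \forall n \near \oo, forall g, G g -> exists2 a, Gn n a & edist2 g a <= e.
Proof.
move=> e0; have [lo [hi bnd]] := geodesics_bounded dnc dncurve hd hcvg uv unu vnv Gng.
apply: ultra_near => U UU oU; apply: contrapT => /ultra_not nU.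
have FtU : Filter U by exact: filter_filter.
have [|g_ [g [Gg' gg gU]]] := ultra_select (P := fun n g =>
    G g /\ forall a, Gn n a -> ~ (edist2 g a <= e)) UU unique_geodesic_compact.
  apply: filterS nU => n /existsNP[g /not_implyP[Gg' ng]].
  by exists g => //; split=> // a Ga ga; apply: ng; exists a.
have [_ _ _ Guv _] := geodesicP dc Gg.
have [/time_le_snd ug /time_le_snd gv] := Guv _ Gg'.
have cK : compact (`[lo.1, hi.1]%classic `*` `[lo.2, hi.2]%classic).
  by apply: compact_setX; exact: segment_compact.
have [|a_ [a [_ aa aU]]] := ultra_select (P := fun n a => Gn n a /\
    `|a.2 - g.2| <= `|(un n).2 - u.2| + `|(vn n).2 - v.2|) UU cK.
  apply: filterS2 (oU _ bnd) (oU _ Gng) => n nK gG.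
  have [_ Gu _ Guvn _] := geodesicP (dnc n) gG.
  have [_ /time_le_snd uvn] := Guvn _ Gu.
  (* The time of [g] may fall slightly outside the time interval of [Gn n]; [r] is its nearest point
     in that interval. *)
  have [r rP rg] : exists2 r, (un n).2 <= r <= (vn n).2 &
      `|r - g.2| <= `|(un n).2 - u.2| + `|(vn n).2 - v.2|.
    have := ler_norm ((un n).2 - u.2); have := ler_norm (v.2 - (vn n).2).
    rewrite (distrC v.2) => h1 h2.
    have := normr_ge0 ((un n).2 - u.2); have := normr_ge0 ((vn n).2 - v.2) => h3 h4.
    have [gu|ug'] := ltP g.2 (un n).2.
      by exists (un n).2; rewrite ?lexx// ger0_norm; lra.
    have [vg|gv'] := ltP (vn n).2 g.2.
      by exists (vn n).2; rewrite ?lexx ?uvn// ltr0_norm; lra.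
    by exists g.2; rewrite ?ug'// subrr normr0; lra.
  have [a Ga ar] := geodesic_ivt_time (dnc n) (@dncurve n) gG rP.
  by exists a; [exact: nK|rewrite ar].
have Ga : G a.
  by apply: (limit_in_geodesic UU oU _ aa); apply: filterS aU => n [].
have ag : a = g.
  apply: unique_geodesic_time => //.
  apply: (cvg_unique (@Rhausdorff R) (cvg_snd_comp FtU aa)).
  apply/cvgrPdist_lt => r r0; have r20 : 0 < r / 2 by rewrite divr_gt0.
  have u2 : \forall n \near U, ball u (r / 2) (un n) by apply: oU; exact: (cvg_ball unu).
  have v2 : \forall n \near U, ball v (r / 2) (vn n) by apply: oU; exact: (cvg_ball vnv).
  apply: filterS3 u2 v2 aU => n [_ u2] [_ v2] [_ ag].
  move: u2 v2; rewrite /ball/= => u2 v2; rewrite distrC; apply: (le_lt_trans ag).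
  by rewrite [ltRHS]splitr ltrD// distrC.
have e20 : 0 < e / 2 by rewrite divr_gt0.
have gE : \forall n \near U, edist2 g (g_ n) < e / 2 by exact: edist2_cvg.
have aE : \forall n \near U, edist2 g (a_ n) < e / 2 by rewrite -ag; exact: edist2_cvg.
have [n [[[[_ nG] [Gan _]] {}gE] {}aE]] :=
  filter_ex (filterI (filterI (filterI gU aU) gE) aE).
apply: (nG _ Gan); apply: le_trans (edist2_triangle g _ _) _.
by rewrite [leRHS]splitr edist2C lerD// ltW.
Qed.

Lemma geodesics_cvg :
  (fun n => set_closure (Gn n)) @ \oo --> ClosedSet unique_geodesic_closed.
Proof.
apply/cvg_ballP => e e0.
have e20 : 0 < e / 2 by rewrite divr_gt0.
have e40 : 0 < e / 2 / 2 by rewrite divr_gt0.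
near=> n; rewrite ball_closed_setE /hausdorff_dist gt_max.
have nGn : forall a, Gn n a -> exists2 g, G g & edist2 a g <= e / 2 / 2.
  by near: n; exact: geodesics_near_limit.
have nG : forall g, G g -> exists2 a, Gn n a & edist2 g a <= e / 2.
  by near: n; exact: limit_near_geodesics.
apply/andP; split; apply: (@le_lt_trans _ _ (e / 2)%:E);
  rewrite ?lte_fin ?ltr_pdivrMr ?ltr_pMr ?ltr1n//; apply: excess_le => x /=.
  by move=> /nG[a Ga ga]; exists a => //; exact: subset_closure.
(* A point of the closure is within [e / 4] of [Gn n], whose points are within [e / 4] of [G]. *)
move=> xcl; have e80 : 0 < e / 2 / 2 / 2 by rewrite divr_gt0.
have [y [Gy /ball_edist2 xy]] := xcl _ (nbhsx_ballx x _ e80).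
have [g Gg' yg] := nGn _ Gy; exists g => //.
apply: le_trans (edist2_triangle y _ _) _.
by rewrite [leRHS]splitr lerD// ltW.
Unshelve. all: by end_near. Qed.

End UniqueGeodesic.

(** * Precompactness and conclusion *)

Lemma geodesic_closures_precompact (R : realType)
    (dn : nat -> plane R -> plane R -> \bar R) d (un vn : nat -> plane R)
    (u v : plane R) (Gn : nat -> set (plane R)) :
  (forall n, causal (dn n)) -> (forall n, monotone_curves (dn n)) ->
  spacetime_metric d -> hypo_cvg dn d -> u.2 < v.2 ->
  un @ \oo --> u -> vn @ \oo --> v ->
  (\forall n \near \oo, geodesic (dn n) (un n) (vn n) (Gn n)) ->
  precompact (range (fun n => set_closure (Gn n))).
Proof.
move=> dnc dncurve hd hcvg uv unu vnv Gng.
have [lo [hi [N _ bnd]]] := geodesics_bounded dnc dncurve hd hcvg uv unu vnv Gng.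
pose K := `[lo.1, hi.1]%classic `*` `[lo.2, hi.2]%classic.
have cK : compact K by apply: compact_setX; exact: segment_compact.
have clK : closed K by apply: compact_closed => //; exact: norm_hausdorff.
(* The uniform bound holds only from [N] on; the earlier closures, possibly unbounded, form a finite
   and hence compact set. *)
apply: (@precompact_subset _ _ ((fun n => set_closure (Gn n)) @` `I_N `|`
  [set A : closed_set R | closed_set_val A `<=` K])).
  move=> _ [n _ <-]; have [nN|Nn] := ltnP n N; first by left; exists n.
  right; apply: subset_trans (closureS (bnd n Nn)) _.
  by rewrite -/K -(closure_id K).1.
apply: compact_precompact; first exact: closed_set_hausdorff.
apply: compactU; last exact: blaschke.
by apply: finite_compact; exact: finite_image.
Qed.

Theorem theorem8p7 (R : realType)
    (dn : nat -> plane R -> plane R -> \bar R)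
    (d : plane R -> plane R -> \bar R)
    (hdn : forall n, directed_metric_neg (dn n))
    (horder : forall n u v, time_lt v u -> dn n u v = -oo%E)
    (hcurve : forall n p q G, geodesic (dn n) p q G -> monotone_curve_image G)
    (hd : spacetime_metric d)
    (hcvg : hypo_cvg dn d)
    (un vn : nat -> plane R) (u v : plane R)
    (huv : R4up (u, v))
    (hunvn : (fun n => (un n, vn n)) @ \oo --> (u, v))
    (hfin : \forall n \near \oo, (-oo < dn n (un n) (vn n))%E)
    (Gn : nat -> set (plane R))
    (hGn : \forall n \near \oo, geodesic (dn n) (un n) (vn n) (Gn n)) :
  precompact (range (fun n => set_closure (Gn n))) /\
  forall G : set (plane R),
    geodesic d u v G -> (forall G', geodesic d u v G' -> G' = G) ->
    exists2 K : closed_set R, closed_set_val K = G &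
      (fun n => set_closure (Gn n)) @ \oo --> K.
Proof.
have dnc n : causal (dn n) by split; [exact: hdn|exact: horder].
have unu : un @ \oo --> u by exact: (cvg_fst_comp _ hunvn).
have vnv : vn @ \oo --> v by exact: (cvg_snd_comp _ hunvn).
split; first exact: (geodesic_closures_precompact dnc hcurve hd hcvg huv unu vnv hGn).
move=> G Gg Guniq; exists (ClosedSet (unique_geodesic_closed hd huv Gg Guniq)) => //.
exact: (geodesics_cvg dnc hcurve hcvg unu vnv hGn).
Qed.
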